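(* Let $A\in\mathbb{N}_{\geq 0}^{m\times n}$, $b\in\mathbb{N}_{>0}^m$, $c\in\mathbb{Z}^n$, the finite set $S=\{x^{(1)},\dots,x^{(k)}\}\subseteq\mathbb{R}^n_{\geq0}\setminus\{0\}$, the cone $C$ it generates, and $N$ be as in the context, and let $\varepsilon\in(0,1)$. Let $\lambda^*$ denote the value $\min_{l: c^Tx^{(l)}>0}\frac{a^Tx^{(l)}}{c^Tx^{(l)}}$, where $a_j=\sum_{i=1}^m y_iA_{ij}$ and $y$ is the initial dual vector $y_i=\delta/b_i$ of the Garg–Könemann procedure described in the context. Given a separation oracle $\mathcal{A}$ for $S$ running in $T_\mathcal{A}$ time and given an initial lower bound $\underline{\lambda}$ for this value satisfying $\underline{\lambda}\le\lambda^*\le m^{\frac{1}{\varepsilon}m}\cdot\underline{\lambda}$, a $(1-\varepsilon)$-approximate solution for the problem $\max\{c^Tx: Ax\le b,\ x\in C\}$ can be determined in $\mathcal{O}\left(\frac{1}{\varepsilon^2}\cdot m\log m\cdot(N+T_\mathcal{A})\right)$ time.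
   Context: Setting: $A\in\mathbb{N}_{\geq 0}^{m\times n}$ has non-negative integer entries and at least one positive entry in each row and each column; $b\in\mathbb{N}_{>0}^m$; $c\in\mathbb{Z}^n$ has entries of arbitrary sign; $N$ is the number of non-zero entries of $A$. $S$ is a finite set of non-zero vectors in $\mathbb{R}^n_{\ge0}$, $C=\{\sum_l\alpha_lx^{(l)}:\alpha_l\ge0\}$ the cone generated by $S$, accessed only via an oracle (the cone is assumed well-described). A separation oracle for $S$ receives $d\in\mathbb{R}^n$ and either states that $d^Tx^{(i)}\ge0$ for all $x^{(i)}\in S$ or returns some $x^{(l)}\in S$ with $d^Tx^{(l)}<0$; its running time satisfies $T_\mathcal{A}\in\Omega(n)$. The Garg–Könemann fractional packing procedure (applied to the reformulation $\max\{\sum_l\alpha_l c^Tx^{(l)}:\sum_l\alpha_l A_{i\cdot}x^{(l)}\le b_i\ \forall i,\ \alpha\ge0\}$ restricted to $l$ with $c^Tx^{(l)}>0$) starts with the dual vector $y_i=\delta/b_i$, $i=1,\dots,m$, where $\delta=\frac{1+\varepsilon'}{((1+\varepsilon')m)^{1/\varepsilon'}}$ and $\varepsilon'=\varepsilon/2$. A $(1-\varepsilon)$-approximate solution is a feasible $x$ with $c^Tx\ge(1-\varepsilon)$ times the optimum value. *)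

(* Defs.v *)
From HB Require Import structures.
From mathcomp Require Export all_boot all_order all_algebra.
From mathcomp Require Export boolp classical_sets reals exp.

Set Implicit Arguments.
Unset Strict Implicit.
Unset Printing Implicit Defensive.

Import Order.TTheory GRing.Theory Num.Theory.
Local Open Scope classical_set_scope.
Local Open Scope ring_scope.

Section PackingOverCone.
Variables (R : realType) (m n k : nat).
Implicit Types (A : 'M[nat]_(m, n)) (b : 'cV[nat]_m) (c : 'cV[int]_n).
Implicit Types (xs : 'I_k -> 'cV[R]_n) (z d : 'cV[R]_n) (eps : R).

Definition dot d z : R := \sum_j d j 0 * z j 0.

Definition cost_vec c : 'cV[R]_n := \col_j (c j 0)%:~R.

Definition nonzeros A : seq ('I_m * 'I_n) :=
  [seq p <- enum [set: 'I_m * 'I_n]%SET | A p.1 p.2 != 0%N].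

Definition cone xs : set 'cV[R]_n :=
  [set z | exists alpha : 'I_k -> R,
     (forall l, 0 <= alpha l) /\ z = \sum_l alpha l *: xs l].

Definition feasible A b xs : set 'cV[R]_n :=
  [set z | cone xs z /\ forall i, \sum_j (A i j)%:R * z j 0 <= (b i 0)%:R].

(* If every column of A has a positive entry and the generators are
   non-negative, the feasible set is compact (and contains 0), so this
   supremum is the maximum. *)
Definition opt_value A b c xs : R :=
  sup [set dot (cost_vec c) z | z in feasible A b xs].

Definition approx_solution A b c xs eps z : Prop :=
  feasible A b xs z /\ (1 - eps) * opt_value A b c xs <= dot (cost_vec c) z.

(* None: "d^T x >= 0 for every generator x". *)
Definition separation_oracle xs (orc : 'cV[R]_n -> option 'cV[R]_n) : Prop :=
  forall d, match orc d with
            | None => forall l, 0 <= dot d (xs l)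
            | Some z => exists2 l, z = xs l & dot d (xs l) < 0
            end.

Definition gk_delta eps : R :=
  let e := eps / 2 in (1 + e) / (((1 + e) * m%:R) `^ (e^-1)).

Definition gk_dual b eps : 'cV[R]_m := \col_i (gk_delta eps / (b i 0)%:R).

Definition gk_length A b eps : 'cV[R]_n :=
  \col_j \sum_i gk_dual b eps i 0 * (A i j)%:R.

(* lambda is the (attained) minimum; in particular some generator has
   positive cost. *)
Definition is_min_ratio A b c xs eps (lambda : R) : Prop :=
  let ratio l := dot (gk_length A b eps) (xs l) / dot (cost_vec c) (xs l) in
  (exists2 l, 0 < dot (cost_vec c) (xs l) & lambda = ratio l) /\
  (forall l, 0 < dot (cost_vec c) (xs l) -> lambda <= ratio l).

End PackingOverCone.

(* A real RAM with an oracle.  A program is a fixed finite text, independent of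
   the instance and of R.  Memory consists of arrays of natural numbers (used
   for indices) and arrays of reals, arrays and cells being numbered by nat; a
   scalar variable is a cell of some array.  Reals admit only exact field
   operations and comparison: there is no rounding, no root, power or
   logarithm, and no conversion between reals and naturals. *)

Inductive nexp : Type :=
| NConst of nat
| NGet of nat & nexp
| NAdd of nexp & nexp
| NSub of nexp & nexp.

Inductive rexp : Type :=
| RConst of nat
| RGet of nat & nexp
| RAdd of rexp & rexp
| RSub of rexp & rexp
| RMul of rexp & rexp
| RDiv of rexp & rexp.

Inductive test : Type :=
| TNLt of nexp & nexp
| TRLt of rexp & rexp
| TNot of test
| TAnd of test & test.

Inductive cmd : Type :=
| Skip
| NSet of nat & nexp & nexp   (* NSet a i e : a[i] := e *)
| RSet of nat & nexp & rexp
| Seq of cmd & cmd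
| If of test & cmd & cmd
| While of test & cmd
(* Query src flag dst: consult the oracle on the vector in the real array src;
   store its verdict in cell 0 of the nat array flag (0: no violated
   generator, 1: one was found), and in the latter case store the generator in
   the real array dst. *)
| Query of nat & nat & nat.

Section Semantics.
Variable R : realType.

Record state : Type := State {
  nmem : nat -> nat -> nat;
  rmem : nat -> nat -> R
}.

Definition update (V : Type) (f : nat -> nat -> V) (a i : nat) (v : V) :=
  fun a' i' => if (a' == a) && (i' == i) then v else f a' i'.

Fixpoint neval (s : state) (e : nexp) : nat :=
  match e with
  | NConst p => p
  | NGet a i => nmem s a (neval s i)
  | NAdd e1 e2 => (neval s e1 + neval s e2)%N
  | NSub e1 e2 => (neval s e1 - neval s e2)%N
  end.

Fixpoint reval (s : state) (e : rexp) : R :=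
  match e with
  | RConst p => p%:R
  | RGet a i => rmem s a (neval s i)
  | RAdd e1 e2 => reval s e1 + reval s e2
  | RSub e1 e2 => reval s e1 - reval s e2
  | RMul e1 e2 => reval s e1 * reval s e2
  | RDiv e1 e2 => reval s e1 / reval s e2
  end.

Fixpoint teval (s : state) (t : test) : bool :=
  match t with
  | TNLt e1 e2 => (neval s e1 < neval s e2)%N
  | TRLt e1 e2 => reval s e1 < reval s e2
  | TNot t1 => ~~ teval s t1
  | TAnd t1 t2 => teval s t1 && teval s t2
  end.

Fixpoint ncost (e : nexp) : nat :=
  match e with
  | NConst _ => 1
  | NGet _ i => (ncost i).+1
  | NAdd e1 e2 | NSub e1 e2 => (ncost e1 + ncost e2).+1
  end.

Fixpoint rcost (e : rexp) : nat :=
  match e with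
  | RConst _ => 1
  | RGet _ i => (ncost i).+1
  | RAdd e1 e2 | RSub e1 e2 | RMul e1 e2 | RDiv e1 e2 =>
      (rcost e1 + rcost e2).+1
  end.

Fixpoint tcost (t : test) : nat :=
  match t with
  | TNLt e1 e2 => (ncost e1 + ncost e2).+1
  | TRLt e1 e2 => (rcost e1 + rcost e2).+1
  | TNot t1 => (tcost t1).+1
  | TAnd t1 t2 => (tcost t1 + tcost t2).+1
  end.

Definition set_nat s a i v := State (update (nmem s) a i v) (rmem s).
Definition set_real s a i v := State (nmem s) (update (rmem s) a i v).

Definition get_vec (n : nat) (s : state) (a : nat) : 'cV[R]_n :=
  \col_(j < n) rmem s a j.

Definition set_vec (n : nat) (s : state) (a : nat) (z : 'cV[R]_n) : state :=
  State (nmem s)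
    (fun a' i' => if a' == a
                  then if insub i' is Some j then z j 0 else rmem s a' i'
                  else rmem s a' i').

Variables (n : nat) (orc : 'cV[R]_n -> option 'cV[R]_n) (T : nat).

Definition answer (s : state) (src flag dst : nat) : state :=
  match orc (get_vec n s src) with
  | None => set_nat s flag 0 0
  | Some z => set_vec (set_nat s flag 0 1) dst z
  end.

(* exec p s s' t: started in s, program p halts in s' after t time units;
   an oracle call takes T units, plus one for the instruction itself. *)
Inductive exec : cmd -> state -> state -> nat -> Prop :=
| exec_skip s : exec Skip s s 1
| exec_nset s a i e :
    exec (NSet a i e) s (set_nat s a (neval s i) (neval s e))
      (ncost i + ncost e).+1
| exec_rset s a i e :
    exec (RSet a i e) s (set_real s a (neval s i) (reval s e))
      (ncost i + rcost e).+1
| exec_seq p q s1 s2 s3 t1 t2 :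
    exec p s1 s2 t1 -> exec q s2 s3 t2 -> exec (Seq p q) s1 s3 (t1 + t2)
| exec_if b p q s s' t :
    exec (if teval s b then p else q) s s' t ->
    exec (If b p q) s s' (tcost b + t).+1
| exec_while_end b p s :
    ~~ teval s b -> exec (While b p) s s (tcost b).+1
| exec_while_step b p s1 s2 s3 t1 t2 :
    teval s1 b -> exec p s1 s2 t1 -> exec (While b p) s2 s3 t2 ->
    exec (While b p) s1 s3 (tcost b + t1 + t2).+1
| exec_query src flag dst s :
    exec (Query src flag dst) s (answer s src flag dst) T.+1.

Lemma exec_det p s s1 s2 t1 t2 :
  exec p s s1 t1 -> exec p s s2 t2 -> s1 = s2 /\ t1 = t2.
Proof.
move=> h; elim: h s2 t2 => {p s s1 t1}
  [s|s a i e|s a i e|p q u1 u2 u3 t1 t2 _ ih1 _ ih2|b p q s s' t _ ih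
  |b p s nb|b p u1 u2 u3 t1 t2 hb _ ih1 _ ih2|src flag dst s] s2 t'.
- by move=> h; inversion h.
- by move=> h; inversion h.
- by move=> h; inversion h.
- move=> h; inversion h as [| | |? ? ? ? ? ? ? h1 h2| | | |]; subst.
  by have [? ?] := ih1 _ _ h1; subst; have [? ?] := ih2 _ _ h2; subst.
- move=> h; inversion h as [| | | |? ? ? ? ? ? h1| | |]; subst.
  by have [? ?] := ih _ _ h1; subst.
- move=> h; inversion h as [| | | | | |? ? ? ? ? ? ? hb|]; subst=> //.
  by rewrite hb in nb.
- move=> h; inversion h as [| | | | |? ? ? nb|? ? ? ? ? ? ? _ h1 h2|]; subst.
    by rewrite hb in nb.
  by have [? ?] := ih1 _ _ h1; subst; have [? ?] := ih2 _ _ h2; subst.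
- by move=> h; inversion h.
Qed.

End Semantics.

Section InputOutput.
Variables (R : realType) (m n : nat).

Definition vec_cells (p : nat) (z : 'cV[R]_p) (i : nat) : R :=
  if insub i is Some j then z j 0 else 0.

(* A is stored sparsely, as the list of its N non-zero entries:
     nat array 0 = m, n, N;  nat arrays 1, 2 = their row and column indices;
     real array 0 = eps, lam;  real array 1 = their values;
     real arrays 2, 3 = b, c.
   All other cells contain 0. *)
Definition init_state (A : 'M[nat]_(m, n)) (b : 'cV[nat]_m) (c : 'cV[int]_n)
    (eps lam : R) : state R :=
  let nz := nonzeros A in
  State
    (fun a i => match a with
       | 0 => nth 0%N [:: m; n; size nz] i
       | 1 => nth 0%N [seq val p.1 | p <- nz] i
       | 2 => nth 0%N [seq val p.2 | p <- nz] i
       | _ => 0%N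
       end)
    (fun a i => match a with
       | 0 => nth 0 [:: eps; lam] i
       | 1 => nth 0 [seq (A p.1 p.2)%:R | p <- nz] i
       | 2 => vec_cells (\col_l (b l 0)%:R) i
       | 3 => vec_cells (cost_vec R c) i
       | _ => 0
       end).

Definition output (s : state R) : 'cV[R]_n := get_vec n s 4.

End InputOutput.

(* Binary logarithm, rounded up to 1 when m = 1: the factor log m of a running
   time would otherwise vanish there.  For m >= 2 this is log_2 m. *)
Definition log_factor (R : realType) (m : nat) : R :=
  Num.max 1 (ln m%:R / ln 2).

(* Main.v *)
Require Import Defs.
From mathcomp Require Import sequences zify ring lra.
Set Implicit Arguments.
Unset Strict Implicit.
Unset Printing Implicit Defensive.
Import Order.TTheory GRing.Theory Num.Theory.
Local Open Scope ring_scope.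

(* A Garg-Koenemann scheme that needs neither the constant delta nor logarithms.
   Write eta = eps/4 and let the load of row i under z be (A z)_i / b_i.  Start from
   y_i = 1/b_i, z = 0 and t = lam: since delta <= 1, lam is a lower bound for the
   ratios (y^T A x) / (c^T x) of the generators x with c^T x > 0.  Query the oracle with
   A^T y - (1 + eta) t c.  If no generator is violated, t may be multiplied by 1 + eta.
   If x is returned, add x to z, scaled so that its maximal load is 1, and multiply y_i
   by 1 + eta * (load of row i under the scaled x).  By weak duality
   t * opt <= b^T y, so b^T y <= m exp (eta (1 + eta) c^T z / opt), while
   b_i y_i >= (1 + eta)^(load of i under z).  Each step adds at least 1 to the sum of the
   loads, hence after m r / eta^2 steps, r >= ln m, some load M is at least r / eta^2,
   and comparing the two bounds shows that z / M is (1 - eps)-approximate.  As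
   y_i b_i <= exp (eta * steps), t is increased at most
   O(steps + (m log m) / eps^2) times. *)

(** * Program logic *)

Fixpoint nwrites (p : cmd) : seq nat :=
  match p with
  | NSet a _ _ => [:: a]
  | Query _ a _ => [:: a]
  | Seq p q | If _ p q => nwrites p ++ nwrites q
  | While _ p => nwrites p
  | _ => [::]
  end.

Fixpoint rwrites (p : cmd) : seq nat :=
  match p with
  | RSet a _ _ => [:: a]
  | Query _ _ a => [:: a]
  | Seq p q | If _ p q => rwrites p ++ rwrites q
  | While _ p => rwrites p
  | _ => [::]
  end.

Section ProgramLogic.
Variables (R : realType) (n : nat) (orc : 'cV[R]_n -> option 'cV[R]_n) (T : nat).
Implicit Types (p q : cmd) (s : state R).

(** Writes are tracked per array and read off the program text, so facts about the other arrays
    carry over by computation. *)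
Definition frame p s s' : Prop :=
  (forall a, a \notin nwrites p -> nmem s' a = nmem s a) /\
  (forall a, a \notin rwrites p -> rmem s' a = rmem s a).

Lemma exec_frame p s s' t : exec orc T p s s' t -> frame p s s'.
Proof.
elim=> {p s s' t}; rewrite /frame /=.
- by [].
- move=> s a i e; split=> // a'; rewrite inE => /negPf ne.
  by apply/funext => j; rewrite /update ne.
- move=> s a i e; split=> // a'; rewrite inE => /negPf ne.
  by apply/funext => j; rewrite /update ne.
- move=> p q s1 s2 s3 t1 t2 _ [n1 r1] _ [n2 r2].
  by split=> a; rewrite mem_cat negb_or => /andP[h1 h2];
    rewrite ?n2 ?n1 ?r2 ?r1.
- move=> b p q s s' t _ [n1 r1].
  split=> a; rewrite mem_cat negb_or => /andP[h1 h2].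
    by apply: n1; case: ifP.
  by apply: r1; case: ifP.
- by [].
- move=> b p s1 s2 s3 t1 t2 _ _ [n1 r1] _ [n2 r2].
  by split=> a h; rewrite ?n2 ?n1 ?r2 ?r1.
- move=> src flag dst s; rewrite /answer.
  case: (orc _) => [z|] /=; split=> // a; rewrite inE => /negPf ne;
    by apply/funext => j; rewrite /update ne.
Qed.

(** A total-correctness triple with time budget [B]. As [exec] is deterministic, exhibiting one run
    determines the behaviour. *)
Definition runs p s (B : nat) (Q : state R -> Prop) : Prop :=
  exists s' t, [/\ exec orc T p s s' t, (t <= B)%N & Q s'].

(** The consequence rule also hands over the frame, so a postcondition need only describe what is
    written. *)
Lemma runs_weaken p s B B' (Q Q' : state R -> Prop) :
  runs p s B Q -> (B <= B')%N ->
  (forall s', frame p s s' -> Q s' -> Q' s') -> runs p s B' Q'.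
Proof.
move=> [s' [t [ex tB Qs]]] le imp; exists s', t; split=> //.
  exact: leq_trans le.
by apply: imp => //; apply: exec_frame ex.
Qed.

Lemma runs_seq p q s B1 B2 (Q1 Q2 : state R -> Prop) :
  runs p s B1 Q1 ->
  (forall s', frame p s s' -> Q1 s' -> runs q s' B2 Q2) ->
  runs (Seq p q) s (B1 + B2) Q2.
Proof.
move=> [s1 [t1 [ex1 le1 h1]]] /(_ s1 (exec_frame ex1) h1).
move=> [s2 [t2 [ex2 le2 h2]]]; exists s2, (t1 + t2)%N; split=> //.
  exact: exec_seq ex1 ex2.
exact: leq_add.
Qed.

Lemma runs_skip s B (Q : state R -> Prop) :
  (0 < B)%N -> Q s -> runs Skip s B Q.
Proof. by move=> B0 h; exists s, 1%N; split=> //; apply: exec_skip. Qed.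

Lemma runs_nset s a i e B (Q : state R -> Prop) :
  (ncost i + ncost e < B)%N -> Q (set_nat s a (neval s i) (neval s e)) ->
  runs (NSet a i e) s B Q.
Proof.
by move=> le h; exists (set_nat s a (neval s i) (neval s e)),
  (ncost i + ncost e).+1; split=> //; apply: exec_nset.
Qed.

Lemma runs_rset s a i e B (Q : state R -> Prop) :
  (ncost i + rcost e < B)%N -> Q (set_real s a (neval s i) (reval s e)) ->
  runs (RSet a i e) s B Q.
Proof.
by move=> le h; exists (set_real s a (neval s i) (reval s e)),
  (ncost i + rcost e).+1; split=> //; apply: exec_rset.
Qed.

Lemma runs_query s src flag dst B (Q : state R -> Prop) :
  (T < B)%N -> Q (answer orc s src flag dst) -> runs (Query src flag dst) s B Q.
Proof.
by move=> le h; exists (answer orc s src flag dst), T.+1; split=> //;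
  apply: exec_query.
Qed.

Lemma runs_if s b p q B B' (Q : state R -> Prop) :
  (tcost b + B < B')%N -> runs (if teval s b then p else q) s B Q ->
  runs (If b p q) s B' Q.
Proof.
move=> ltB [s' [t [ex le h]]]; exists s', (tcost b + t).+1; split=> //.
  exact: exec_if.
by apply: leq_trans ltB; rewrite ltnS leq_add2l.
Qed.

(** The invariant is indexed by the number of completed iterations, and the bound [B] on that index
    doubles as termination measure. The last summand pays for the failing test. *)
Lemma runs_while b p (J : nat -> state R -> Prop) C B s :
  J 0%N s -> (forall k s', J k s' -> (k <= B)%N) ->
  (forall k s', J k s' -> teval s' b -> runs p s' C (J k.+1)) ->
  runs (While b p) s (B * (tcost b + C).+1 + (tcost b).+1)
    (fun s' => exists2 k, J k s' & ~~ teval s' b).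
Proof.
move=> J0 JB Jstep.
suff H d : forall k0 s1, J k0 s1 -> (B - k0 <= d)%N ->
    exists k, runs (While b p) s1 (k * (tcost b + C).+1 + (tcost b).+1)
      (fun s' => J (k0 + k)%N s' /\ ~~ teval s' b).
  have [k [s' [t [ex le [Jk nb]]]]] := H B 0%N s J0 (leq_subr _ _).
  exists s', t; split=> //; last by exists k.
  apply: (leq_trans le); rewrite leq_add2r leq_mul2r.
  by rewrite (JB _ _ Jk) orbT.
elim: d => [|d IH] k0 s1 J1 le; case: (boolP (teval s1 b)) => hb;
  try by exists 0%N; exists s1, (tcost b).+1; rewrite addn0; split;
    [apply: exec_while_end| |].
- have [s2 [t [_ _ /JB]]] := Jstep _ _ J1 hb.
  by move: le; lia.
- have [s2 [t [ex1 le1 J2]]] := Jstep _ _ J1 hb.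
  have := JB _ _ J2 => ltB.
  have /(IH _ _ J2)[k [s3 [t3 [ex3 le3 h3]]]] : (B - k0.+1 <= d)%N by lia.
  exists k.+1; exists s3, (tcost b + t + t3).+1; split.
  + exact: exec_while_step ex3.
  + by rewrite mulSn; lia.
  + by rewrite addnS -addSn.
Qed.

End ProgramLogic.

(* Nat array 3 is reserved for loop counters; nat array 0 holds m, n, N. *)
Definition counter : nexp := NGet 3 (NConst 0).
Definition for_ (r : nat) (body : cmd) : cmd :=
  Seq (NSet 3 (NConst 0) (NConst 0))
    (While (TNLt counter (NGet 0 (NConst r)))
       (Seq body (NSet 3 (NConst 0) (NAdd counter (NConst 1))))).

(** * Loop patterns: pointwise maps, scattered sums, maxima *)

Section Loops.
Variables (R : realType) (n : nat) (orc : 'cV[R]_n -> option 'cV[R]_n) (T : nat).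
Implicit Types (s : state R) (f : nat -> nat -> R).
Local Notation runs := (runs orc T).

Definition in_iteration s j s1 : Prop :=
  (forall a, a != 3%N -> nmem s1 a = nmem s a) /\ nmem s1 3 0%N = j.

(** A body that writes no natural-number array preserves both the counter and the trip count. The 12
    units pay for test and increment in each iteration, the 10 for initialisation and the final
    test. *)
Lemma runs_for r body (J : nat -> (nat -> nat -> R) -> Prop) C s :
  nwrites body = [::] -> J 0%N (rmem s) ->
  (forall j s1, (j < nmem s 0 r)%N -> in_iteration s j s1 -> J j (rmem s1) ->
     runs body s1 C (fun s2 => J j.+1 (rmem s2))) ->
  runs (for_ r body) s (nmem s 0 r * (C + 12) + 10)
    (fun s' => J (nmem s 0 r) (rmem s')).
Proof.
move=> nw J0 Jstep; set N := nmem s 0 r.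
pose J' k s1 := [/\ (k <= N)%N, in_iteration s k s1 & J k (rmem s1)].
apply: (@runs_weaken _ _ _ _ _ _ (4 + (N * (C + 12) + 6)) _
  (fun s' => J N (rmem s'))); [|lia|by []].
apply: (runs_seq (Q1 := J' 0%N)).
  apply: runs_nset => //; split=> //=.
  split=> /= [a /negPf ne|]; last by rewrite /update.
  by apply/funext => i; rewrite /update ne.
move=> s1 _ J1.
apply: (@runs_weaken _ _ _ _ _ _ (N * (5 + (C + 6)).+1 + 6) _
  (fun s' => exists2 k, J' k s' & ~~ teval s' (TNLt counter (NGet 0 (NConst r))))).
- apply: (@runs_while _ _ orc T _ _ J' (C + 6) N) => //.
    by move=> k s' [].
  move=> k s2 [kN it Jk] /=; have [eqn eqk] := it.
  rewrite eqk eqn // => ltk.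
  apply: (runs_seq (Q1 := fun s' => nmem s' = nmem s2 /\ J k.+1 (rmem s'))).
    apply: runs_weaken (Jstep _ _ ltk it Jk) (leqnn _) _ => s3 [fr _] J3.
    by split=> //; apply/funext => a; apply: fr; rewrite nw.
  move=> s3 _ [eqs J3].
  apply: runs_nset => //; split=> //=; split=> /= [a ne|].
    apply/funext => i; rewrite /update (negPf ne) /= eqs.
    exact: (congr1 (@^~ i) (eqn a ne)).
  by rewrite /update /= eqs eqk addn1.
- by lia.
- move=> s' _ [k [kN [eqn eqk] Jk]] /=; rewrite eqk eqn // -leqNgt => Nk.
  by have -> : N = k by apply/eqP; rewrite eqn_leq kN Nk.
Qed.

(** Iteration [j] finds cell [j] of array [a] still at its old value, so [e] may read the cell being
    overwritten. *)
Lemma runs_map r a e (F : nat -> R) s :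
  (forall j s1, (j < nmem s 0 r)%N -> in_iteration s j s1 ->
     rmem s1 a j = rmem s a j ->
     (forall a', a' != a -> rmem s1 a' = rmem s a') -> reval s1 e = F j) ->
  runs (for_ r (RSet a counter e)) s (nmem s 0 r * (rcost e + 15) + 10)
    (fun s' => forall i, (i < nmem s 0 r)%N -> rmem s' a i = F i).
Proof.
move=> eF.
pose J j f := [/\ forall i, (i < j)%N -> f a i = F i,
  forall i, (j <= i)%N -> f a i = rmem s a i
  & forall a', a' != a -> f a' = rmem s a'].
apply: (@runs_weaken _ _ _ _ _ _ _ _ (fun s' => J (nmem s 0 r) (rmem s')));
  last by move=> s' _ [].
- apply: (@runs_for _ _ J (rcost e + 3)) => //.
  move=> j s1 ltj it [h1 h2 h3].
  apply: runs_rset.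
    by rewrite /=; lia.
  - rewrite /= (it.2) (eF j s1 ltj it (h2 _ (leqnn _)) h3); split=> /=.
    + move=> i; rewrite ltnS leq_eqVlt /update eqxx /= => /orP[/eqP->|lt].
        by rewrite eqxx.
      by rewrite (ltn_eqF lt) h1.
    + move=> i lt; rewrite /update eqxx /= (gtn_eqF lt) h2 //; exact: ltnW.
    + move=> a' ne; apply/funext => i; rewrite /update (negPf ne) /=.
      exact: (congr1 (@^~ i) (h3 a' ne)).
- by rewrite leq_add2r leq_mul2l; apply/orP; right; lia.
Qed.

(** Several iterations may hit the same cell, so a cell collects the sum over a fibre of [idx].
    Products with the sparse matrix are formed this way. *)
Lemma runs_scatter r a ix e (idx : nat -> nat) (F : nat -> R) s :
  (forall j s1, (j < nmem s 0 r)%N -> in_iteration s j s1 ->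
     neval s1 ix = idx j) ->
  (forall j s1, (j < nmem s 0 r)%N -> in_iteration s j s1 ->
     (forall a', a' != a -> rmem s1 a' = rmem s a') -> reval s1 e = F j) ->
  runs (for_ r (RSet a ix (RAdd (RGet a ix) e))) s
    (nmem s 0 r * (2 * ncost ix + rcost e + 15) + 10)
    (fun s' => forall i,
       rmem s' a i = rmem s a i + \sum_(j < nmem s 0 r | idx j == i) F j).
Proof.
move=> eidx eF.
pose J j f := (forall i, f a i = rmem s a i + \sum_(l < j | idx l == i) F l) /\
  (forall a', a' != a -> f a' = rmem s a').
apply: (@runs_weaken _ _ _ _ _ _ _ _ (fun s' => J (nmem s 0 r) (rmem s')));
  last by move=> s' _ [].
- apply: (@runs_for _ _ J (2 * ncost ix + rcost e + 3)) => //.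
    by split=> // i; rewrite big_ord0 addr0.
  move=> j s1 ltj it [h1 h2].
  apply: runs_rset.
    by rewrite /=; lia.
  - rewrite /= (eidx j s1 ltj it) (eF j s1 ltj it h2); split=> /=.
    + move=> i; rewrite /update eqxx /= big_mkcond big_ord_recr -big_mkcond /=.
      rewrite [i == _]eq_sym; case: eqP => [->|_]; first by rewrite h1 addrA.
      by rewrite addr0 h1.
    + move=> a' ne; apply/funext => i; rewrite /update (negPf ne) /=.
      exact: (congr1 (@^~ i) (h2 a' ne)).
- by rewrite leq_add2r leq_mul2l; apply/orP; right; lia.
Qed.

(** The running maximum starts at 0, hence the alternative that the value is 0 instead of some
    [F j]. *)
Definition is_max (N : nat) (F : nat -> R) (v : R) : Prop :=
  [/\ 0 <= v, forall j, (j < N)%N -> F j <= v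
    & v = 0 \/ exists2 j, (j < N)%N & v = F j].

Lemma runs_max r a e (F : nat -> R) s :
  (forall j s1, (j < nmem s 0 r)%N -> in_iteration s j s1 ->
     (forall a', a' != a -> rmem s1 a' = rmem s a') -> reval s1 e = F j) ->
  rmem s a 0%N = 0 ->
  runs (for_ r (If (TRLt (RGet a (NConst 0)) e) (RSet a (NConst 0) e) Skip)) s
    (nmem s 0 r * (2 * rcost e + 20) + 10)
    (fun s' => is_max (nmem s 0 r) F (rmem s' a 0%N)).
Proof.
move=> eF s0.
pose J j f := is_max j F (f a 0%N) /\
  (forall a', a' != a -> f a' = rmem s a').
apply: (@runs_weaken _ _ _ _ _ _ _ _ (fun s' => J (nmem s 0 r) (rmem s')));
  last by move=> s' _ [].
- apply: (@runs_for _ _ J (2 * rcost e + 8)) => //.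
    by rewrite /J /is_max s0; split=> //; split=> //; left.
  move=> j s1 ltj it [[p1 p2 p3] h2].
  apply: (runs_if (B := (rcost e + 3)%N)); first by rewrite /=; lia.
  rewrite /= (eF j s1 ltj it h2); case: ltP => le.
    apply: runs_rset; first by rewrite /=; lia.
    split=> /=.
      rewrite /update !eqxx /= (eF j s1 ltj it h2); split.
      + by rewrite ltW // (le_lt_trans p1).
      + move=> i; rewrite ltnS leq_eqVlt => /orP[/eqP-> //|/p2 le'].
        by rewrite ltW // (le_lt_trans le').
      + by right; exists j.
    move=> a' ne; apply/funext => i; rewrite /update (negPf ne) /=.
    exact: (congr1 (@^~ i) (h2 a' ne)).
  apply: runs_skip; first by lia.
  split=> //; split=> //.
    by move=> i; rewrite ltnS leq_eqVlt => /orP[/eqP-> //|/p2].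
  by case: p3 => [|[i lti ->]]; [left|right; exists i => //; apply: ltnW].
- by rewrite leq_add2r leq_mul2l; apply/orP; right; lia.
Qed.

End Loops.

(** * Analysis of the packing scheme *)

Section LogInequalities.
Variable R : realType.
Implicit Types x w : R.

Lemma ln_ge x : 0 < x -> 1 - x^-1 <= ln x.
Proof.
move=> x0; have xV : 0 < x^-1 by rewrite invr_gt0.
have : -1 < x^-1 - 1 by lra.
by move/le_ln1Dx; rewrite [1 + _]addrC subrK lnV ?posrE //; lra.
Qed.

Lemma ln1D_ge x : 0 < x -> x / (1 + x) <= ln (1 + x).
Proof.
move=> x0; suff -> : x / (1 + x) = 1 - (1 + x)^-1 by apply: ln_ge; lra.
by field; lra.
Qed.

(** Bernoulli's inequality [(1 + x)^w <= 1 + x w]: it makes the multiplicative dual updates dominate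
    an exponential of the load. *)
Lemma expR_ln1D_le x w : 0 < x -> 0 <= w <= 1 ->
  expR (ln (1 + x) * w) <= 1 + x * w.
Proof.
move=> x0 /andP[w0 w1]; set v := 1 + x * w.
have v0 : 0 < v by rewrite ltr_wpDr // mulr_ge0 // ltW.
rewrite -ler_ln ?posrE ?expR_gt0 // expRK.
(* concavity of ln, from its tangent at v *)
have tangent u : 0 < u -> ln u <= ln v + (u / v - 1).
  move=> u0; have uv : 0 < u / v by rewrite divr_gt0.
  have : -1 < u / v - 1 by lra.
  by move/le_ln1Dx; rewrite [1 + _]addrC subrK ln_div ?posrE //; lra.
have x1 : 0 < 1 + x by lra.
have h1 := ler_wpM2r w0 (tangent _ x1).
have w1' : 0 <= 1 - w by lra.
have h2 := ler_wpM2r w1' (tangent _ ltr01).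
(* As [v] is the mean of [1 + x] and 1 with weights [w] and [1 - w], the linear terms of the two
   tangent bounds cancel. *)
have : ((1 + x) / v - 1) * w + (1 / v - 1) * (1 - w) = 0.
  by rewrite /v; field; rewrite gt_eqF.
by rewrite ln1 in h2; move: h1 h2; rewrite !mulrDl; lra.
Qed.

Lemma ln2_bounds : 2^-1 <= ln (2 : R) <= 1.
Proof.
have h1 := @ln_ge 2 ltac:(by lra).
have := @le_ln1Dx R 1 ltac:(by lra).
have -> : 1 + 1 = 2 :> R by [].
by move=> h2; apply/andP; split; lra.
Qed.

Lemma log_factor_ge1 m : 1 <= log_factor R m.
Proof. by rewrite /log_factor le_max lexx. Qed.

Lemma ln_le_log_factor m : ln m%:R <= log_factor R m.
Proof.
have /andP[l2 l2'] := ln2_bounds.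
rewrite /log_factor le_max; apply/orP; right.
case: m => [|m]; first by rewrite ln0 // mul0r.
rewrite ler_pdivlMr; last by lra.
by rewrite ler_piMr // ln_ge0 // ler1n.
Qed.

(** Limits how often 1 can be doubled while staying below [m]. *)
Lemma leq_expn_log_factor m i : (2 ^ i < m)%N -> i%:R <= log_factor R m.
Proof.
have /andP[l2 l2'] := ln2_bounds.
move=> lt; rewrite /log_factor le_max; apply/orP; right.
rewrite ler_pdivlMr; last by lra.
rewrite mulr_natl -lnXn; last by lra.
have m0 : 0 < m%:R :> R by rewrite ltr0n; apply: leq_ltn_trans lt.
have p0 : 0 < 2 ^+ i :> R by apply: exprn_gt0; lra.
by rewrite ler_ln ?posrE // -natrX ler_nat ltnW.
Qed.

End LogInequalities.

(** * Size of the initial dual scale *)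

Section DeltaBounds.
Variables (R : realType) (m : nat) (eps : R).
Hypotheses (m_gt0 : (0 < m)%N) (eps_gt0 : 0 < eps) (eps_lt1 : eps < 1).

Local Lemma m_ge1 : 1 <= m%:R :> R. Proof. by rewrite ler1n. Qed.

Lemma gk_delta_gt0 : 0 < gk_delta m eps.
Proof.
have e_gt0 := eps_gt0; have e_lt1 := eps_lt1.
have m1 := m_ge1; have e1 : 0 < 1 + eps / 2 by lra.
rewrite /gk_delta; apply: divr_gt0 => //.
by apply: powR_gt0; apply: mulr_gt0 => //; lra.
Qed.

(** Base [(1 + eps/2) m] and exponent [2/eps] are both at least 1, so the denominator is at least
    its base, hence at least the numerator. *)
Lemma gk_delta_le1 : gk_delta m eps <= 1.
Proof.
have e_gt0 := eps_gt0; have e_lt1 := eps_lt1.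
have m1 := m_ge1; have e1 : 1 <= 1 + eps / 2 by lra.
have h : 1 <= (1 + eps / 2) * m%:R by rewrite -[leLHS]mulr1 ler_pM.
rewrite /gk_delta /= ler_pdivrMr; last by rewrite powR_gt0; lra.
rewrite mul1r; apply: (@le_trans _ _ ((1 + eps / 2) * m%:R)).
  by rewrite ler_peMr //; lra.
by apply: le1r_powR => //; rewrite invf_ge1; lra.
Qed.

(** The exponent [2/eps] comes down as a factor. Starting without [delta] thus widens the range of
    [t] by little on a logarithmic scale. *)
Lemma ln_gk_deltaV : ln (gk_delta m eps)^-1 <= 2 / eps * (1 + ln m%:R).
Proof.
have e_gt0 := eps_gt0; have e_lt1 := eps_lt1.
have m0 : 0 < m%:R :> R by have := m_ge1; lra.
have h : 0 < (1 + eps / 2) * m%:R by rewrite mulr_gt0 //; lra.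
have hp := powR_gt0 (eps / 2)^-1 h.
have e1 : 0 < 1 + eps / 2 by lra.
rewrite lnV ?posrE ?gk_delta_gt0 // /gk_delta /= ln_div ?posrE //.
rewrite opprB ln_powR lnM ?posrE //.
have l1 : ln (1 + eps / 2) <= 1 by have := @le_ln1Dx R (eps / 2) ltac:(by lra); lra.
have l0 : 0 <= ln (1 + eps / 2) by rewrite ln_ge0 //; lra.
have -> : (eps / 2)^-1 = 2 / eps by field; rewrite gt_eqF.
rewrite lerBlDr.
apply: (@le_trans _ _ (2 / eps * (1 + ln m%:R))); last by rewrite lerDl.
by rewrite ler_wpM2l ?lerD2r // divr_ge0 //; lra.
Qed.

End DeltaBounds.

(** * The packing invariant and its consequences *)

Section Packing.
Variables (R : realType) (m n k : nat).
Variables (A : 'M[nat]_(m, n)) (b : 'cV[nat]_m) (c : 'cV[int]_n).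
Variables (xs : 'I_k -> 'cV[R]_n) (eps lam lamstar : R).
Hypotheses (colA : forall j, exists i, (0 < A i j)%N)
  (b_gt0 : forall i, (0 < b i 0%R)%N)
  (xs_pos : forall l, xs l != 0 /\ forall j, 0 <= xs l j 0)
  (eps01 : 0 < eps < 1)
  (lamstarP : is_min_ratio A b c xs eps lamstar)
  (lamP : lam <= lamstar <= (m%:R `^ (eps^-1 * m%:R)) * lam).

Implicit Types (y : 'I_m -> R) (x z : 'cV[R]_n).

Local Notation eta := (eps / 4).
Local Notation V := (opt_value A b c xs).
Local Notation cost := (dot (cost_vec R c)).

Definition usage z (i : 'I_m) : R := \sum_j (A i j)%:R * z j 0.
Definition load z (i : 'I_m) : R := usage z i / (b i 0)%:R.
(** The reduced costs [A^T y - t c]; the oracle applied to them tests whether [t] bounds the ratios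
    from below. *)
Definition reduced y (t : R) : 'cV[R]_n :=
  \col_j (\sum_i (A i j)%:R * y i - t * cost_vec R c j 0).

Local Lemma bR_gt0 i : 0 < (b i 0%R)%:R :> R. Proof. by rewrite ltr0n. Qed.
Local Lemma eps_gt0 : 0 < eps. Proof. by case/andP: eps01. Qed.
Local Lemma eps_lt1 : eps < 1. Proof. by case/andP: eps01. Qed.

#[local] Hint Resolve bR_gt0 eps_gt0 eps_lt1 : core.

Lemma usage_lin (I : finType) (al : I -> R) (v : I -> 'cV[R]_n) i :
  usage (\sum_l al l *: v l) i = \sum_l al l * usage (v l) i.
Proof.
rewrite /usage; under [RHS]eq_bigr do rewrite mulr_sumr.
rewrite exchange_big /=; apply: eq_bigr => j _.
rewrite summxE mulr_sumr; apply: eq_bigr => l _.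
by rewrite mxE; ring.
Qed.

Lemma dot_lin (I : finType) (d : 'cV[R]_n) (al : I -> R) (v : I -> 'cV[R]_n) :
  dot d (\sum_l al l *: v l) = \sum_l al l * dot d (v l).
Proof.
rewrite /dot; under [RHS]eq_bigr do rewrite mulr_sumr.
rewrite exchange_big /=; apply: eq_bigr => j _.
rewrite summxE mulr_sumr; apply: eq_bigr => l _.
by rewrite mxE; ring.
Qed.

Lemma dot0 (d : 'cV[R]_n) : dot d 0 = 0.
Proof. by rewrite /dot big1 // => j _; rewrite [X in _ * X]mxE mulr0. Qed.

Lemma usage0 i : usage 0 i = 0.
Proof. by rewrite /usage big1 // => j _; rewrite [X in _ * X]mxE mulr0. Qed.

Lemma usageDZ z (t : R) x i : usage (z + t *: x) i = usage z i + t * usage x i.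
Proof.
rewrite /usage mulr_sumr -big_split; apply: eq_bigr => j _ /=.
by rewrite !mxE; ring.
Qed.

Lemma usageZ (t : R) x i : usage (t *: x) i = t * usage x i.
Proof. by rewrite /usage mulr_sumr; apply: eq_bigr => j _; rewrite mxE; ring. Qed.

Lemma dotDZ (d : 'cV[R]_n) z (t : R) x : dot d (z + t *: x) = dot d z + t * dot d x.
Proof.
rewrite /dot mulr_sumr -big_split; apply: eq_bigr => j _ /=.
by rewrite !mxE; ring.
Qed.

Lemma dotZ (d : 'cV[R]_n) (t : R) x : dot d (t *: x) = t * dot d x.
Proof. by rewrite /dot mulr_sumr; apply: eq_bigr => j _; rewrite mxE; ring. Qed.

Lemma dot_reduced y t x :
  dot (reduced y t) x = \sum_i y i * usage x i - t * cost x.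
Proof.
rewrite /dot /usage; under [X in X - _]eq_bigr do rewrite mulr_sumr.
rewrite exchange_big /= mulr_sumr -sumrB; apply: eq_bigr => j _.
rewrite mxE mulrBl mulr_suml; congr (_ - _); last by rewrite mulrA.
by apply: eq_bigr => i _; ring.
Qed.

Lemma usage_ge0 l i : 0 <= usage (xs l) i.
Proof. by apply: sumr_ge0 => j _; rewrite mulr_ge0 // (xs_pos l).2. Qed.

Lemma load_ge0 l i : 0 <= load (xs l) i.
Proof. by rewrite divr_ge0 ?usage_ge0. Qed.

(** A nonzero nonnegative generator has a positive coordinate, whose column in [A] has a positive
    entry. Hence scaling to maximal load 1 is possible. *)
Lemma exists_load_gt0 l : exists i, 0 < load (xs l) i.
Proof.
have [xn0 x0] := xs_pos l.
have [j xj] : exists j, 0 < xs l j 0.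
  have [/existsP//|] := boolP [exists j, 0 < xs l j 0].
  rewrite negb_exists => /forallP h; case/negP: xn0; apply/eqP/matrixP => j o.
  rewrite ord1 !mxE; apply/eqP; rewrite eq_le x0 andbT leNgt; exact: h.
have [i Aij] := colA j; exists i; rewrite /load divr_gt0 // /usage (bigD1 j) //=.
rewrite ltr_wpDr ?mulr_gt0 ?ltr0n //.
by apply: sumr_ge0 => j' _; rewrite mulr_ge0.
Qed.

(** The inequality on generators extends to conic combinations, so a feasible [z] satisfies
    [t c^T z <= y^T A z <= b^T y]. *)
Lemma weak_duality y t :
  (forall i, 0 <= y i) -> 0 < t ->
  (forall l, t * cost (xs l) <= \sum_i y i * usage (xs l) i) ->
  t * V <= \sum_i (b i 0)%:R * y i.
Proof.
move=> y0 t0 lb; rewrite mulrC -ler_pdivlMr //; apply: ge_sup.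
  exists 0, 0; last exact: dot0.
  split; first by exists (fun=> 0); split=> //; rewrite big1 // => l _; rewrite scale0r.
  by move=> i; have := usage0 i; rewrite /usage => ->.
move=> _ [z [[al [al0 ->]] fz] <-]; rewrite ler_pdivlMr // mulrC.
rewrite dot_lin mulr_sumr.
apply: (@le_trans _ _ (\sum_i y i * usage (\sum_l al l *: xs l) i)); last first.
  by apply: ler_sum => i _; rewrite [leRHS]mulrC; apply: ler_wpM2l; [|exact: fz].
under [leRHS]eq_bigr do rewrite usage_lin mulr_sumr.
rewrite exchange_big; apply: ler_sum => l _ /=.
rewrite mulrCA; apply: (le_trans (ler_wpM2l (al0 l) (lb l))).
by rewrite mulr_sumr le_eqVlt; apply/orP; left; apply/eqP/eq_bigr => i _; ring.
Qed.

(* f counts the packing steps and g the increases of the lower bound t. *)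
Record gk_inv y z (t : R) (f g : nat) : Prop := GKInv {
  gk_t : t = lam * (1 + eta) ^+ g;
  gk_lower : forall l, t * cost (xs l) <= \sum_i y i * usage (xs l) i;
  gk_cone : cone xs z;
  gk_cost : 0 <= cost z;
  gk_potential : 0 < V ->
    \sum_i (b i 0)%:R * y i <= m%:R * expR (eta * (1 + eta) * cost z / V);
  gk_exp_load : forall i, expR (ln (1 + eta) * load z i) <= (b i 0)%:R * y i;
  gk_upper : forall i, (b i 0)%:R * y i <= expR (eta * f%:R);
  gk_count : f%:R <= \sum_i load z i
}.

Lemma gk_dual_gt0 y z t f g : gk_inv y z t f g -> forall i, 0 < y i.
Proof.
move=> I i; have := lt_le_trans (expR_gt0 _) (gk_exp_load I i).
by rewrite pmulr_rgt0.
Qed.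

(** The generator attaining [lamstar] puts a positive load on some row. *)
Lemma m_gt0 : (0 < m)%N.
Proof.
have [[l _ _] _] := lamstarP; have [i _] := exists_load_gt0 l.
exact: leq_ltn_trans (ltn_ord i).
Qed.

Local Notation delta := (gk_delta m eps).
Local Lemma delta_gt0 : 0 < delta.
Proof. by apply: gk_delta_gt0; rewrite ?m_gt0 ?eps_gt0 ?eps_lt1. Qed.

#[local] Hint Resolve delta_gt0 : core.

Lemma dot_gk_length x : dot (gk_length A b eps) x = delta * \sum_i load x i.
Proof.
rewrite /dot mulr_sumr; under eq_bigr do rewrite mxE mulr_suml.
rewrite exchange_big; apply: eq_bigr => i _ /=.
rewrite /load /usage mulr_suml mulr_sumr; apply: eq_bigr => j _.
by rewrite mxE; ring.
Qed.

Lemma sum_load_gt0 l : 0 < \sum_i load (xs l) i.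
Proof.
have [i hi] := exists_load_gt0 l; rewrite (bigD1 i) //= ltr_wpDr //.
by apply: sumr_ge0 => i' _; apply: load_ge0.
Qed.

Lemma lamstar_gt0 : 0 < lamstar.
Proof.
have [[l cl ->] _] := lamstarP.
by rewrite dot_gk_length divr_gt0 // mulr_gt0 // sum_load_gt0.
Qed.

(** Positivity comes from the upper half of the sandwich: [lamstar] is positive and at most a
    positive multiple of [lam]. *)
Lemma lam_gt0 : 0 < lam.
Proof.
have /andP[_ h] := lamP; have := lt_le_trans lamstar_gt0 h.
by rewrite pmulr_rgt0 // powR_gt0 // ltr0n m_gt0.
Qed.

Lemma gk_t_gt0 y z t f g : gk_inv y z t f g -> 0 < t.
Proof.
move=> I; rewrite (gk_t I) mulr_gt0 ?lam_gt0 // exprn_gt0 //.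
by have := eps_gt0; lra.
Qed.

(* Dropping the factor delta from the initial dual vector keeps lam a lower
   bound, as delta <= 1. *)
Lemma gk_inv_init : gk_inv (fun i => 1 / (b i 0)%:R) 0 lam 0 0.
Proof.
have by1 i : (b i 0)%:R * (1 / (b i 0)%:R) = 1 :> R.
  by rewrite mul1r divff // gt_eqF.
split.
- by rewrite expr0 mulr1.
- move=> l; have -> : \sum_i 1 / (b i 0)%:R * usage (xs l) i = \sum_i load (xs l) i.
    by apply: eq_bigr => i _; rewrite /load; ring.
  (* At nonpositive cost the left side is nonpositive, while the total load is positive; only
     positive costs involve [lamstar]. *)
  have [cl|cl] := leP (cost (xs l)) 0.
    apply: (@le_trans _ _ 0); last exact: ltW (sum_load_gt0 l).
    by rewrite mulr_ge0_le0 // ltW // lam_gt0.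
  have [_ /(_ l cl)] := lamstarP.
  rewrite dot_gk_length ler_pdivlMr // => le.
  have /andP[lle _] := lamP.
  apply: le_trans (ler_wpM2r (ltW cl) lle) _; apply: (le_trans le).
  rewrite ger_pMl ?sum_load_gt0 //.
  by apply: gk_delta_le1; rewrite ?m_gt0.
- by exists (fun=> 0); split=> //; rewrite big1 // => l _; rewrite scale0r.
- by rewrite dot0.
- move=> _; under eq_bigr do rewrite by1.
  by rewrite dot0 mulr0 mul0r expR0 sumr_const card_ord mulr1.
- by move=> i; rewrite /load usage0 mul0r mulr0 expR0 by1.
- by move=> i; rewrite by1 mulr0 expR0.
- by apply: sumr_ge0 => i _; rewrite /load usage0 mul0r.
Qed.

(** Only [t] and [g] change, and the absence of a violated generator is precisely [gk_lower] at the
    raised [t]. *)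
Lemma gk_inv_raise y z t f g :
  gk_inv y z t f g ->
  (forall l, 0 <= dot (reduced y ((1 + eta) * t)) (xs l)) ->
  gk_inv y z ((1 + eta) * t) f g.+1.
Proof.
move=> I h; split; try by case: I.
  by rewrite (gk_t I) exprS; ring.
by move=> l; have := h l; rewrite dot_reduced subr_ge0.
Qed.

(** With [v] the maximal load of the generator, its scaled loads [w i] lie between 0 and 1 and one
    of them equals 1. Since [y] only grows, the lower bound [t] stays valid. *)
Lemma gk_inv_step y z t f g l v :
  gk_inv y z t f g ->
  dot (reduced y ((1 + eta) * t)) (xs l) < 0 ->
  (forall i, load (xs l) i <= v) -> (v = 0 \/ exists i, v = load (xs l) i) ->
  gk_inv (fun i => y i * (1 + eta * (load (xs l) i / v)))
    (z + v^-1 *: xs l) t f.+1 g.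
Proof.
move=> I; rewrite dot_reduced subr_lt0 => hl vmax vatt.
have t0 := gk_t_gt0 I; have y0 := gk_dual_gt0 I.
have eta0 : 0 < eta by have := eps_gt0; lra.
have v0 : 0 < v by have [i hi] := exists_load_gt0 l; apply: lt_le_trans (vmax i).
have {vatt} [i0 vi0] : exists i, v = load (xs l) i.
  by case: vatt => // v00; rewrite v00 ltxx in v0.
pose w i := load (xs l) i / v.
have w01 i : 0 <= w i <= 1.
  by rewrite /w divr_ge0 ?load_ge0 ?(ltW v0) // ler_pdivrMr // mul1r vmax.
have w0 i : 0 <= w i by case/andP: (w01 i).
have ew0 i : 0 <= eta * w i by rewrite mulr_ge0 // ltW.
(* Usages are nonnegative, so a violated generator must have positive cost. *)
have cl : 0 < cost (xs l).
  have : 0 < (1 + eta) * t * cost (xs l).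
    apply: le_lt_trans hl; apply: sumr_ge0 => i _.
    by rewrite mulr_ge0 ?usage_ge0 // ltW.
  by rewrite pmulr_rgt0 // mulr_gt0 //; lra.
have loadD i : load (z + v^-1 *: xs l) i = load z i + w i.
  by rewrite /load usageDZ /w /load; ring.
split.
- exact: gk_t I.
- move=> l'; apply: (le_trans (gk_lower I l')); apply: ler_sum => i _.
  apply: ler_wpM2r; first exact: usage_ge0.
  by apply: ler_peMr; [exact: ltW|rewrite lerDl; exact: ew0].
- have [al [al0 ->]] := gk_cone I.
  exists (fun l' => al l' + (l' == l)%:R * v^-1); split.
    by move=> l'; rewrite addr_ge0 // mulr_ge0 // invr_ge0 ltW.
  under [RHS]eq_bigr do rewrite scalerDl.
  rewrite big_split /=; congr (_ + _).
  rewrite (bigD1 l) //= eqxx mul1r big1 ?addr0 // => l' /negPf ->.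
  by rewrite mul0r scale0r.
- rewrite dotDZ addr_ge0 ?(gk_cost I) // mulr_ge0 ?invr_ge0 // ltW //.
- move=> V0.
  have dual := weak_duality (fun i => ltW (y0 i)) t0 (gk_lower I).
  set D := \sum_i _ in dual.
  have -> : \sum_i (b i 0)%:R * (y i * (1 + eta * (load (xs l) i / v)))
      = D + eta / v * \sum_i y i * usage (xs l) i.
    rewrite mulr_sumr -big_split; apply: eq_bigr => i _ /=.
    by rewrite /load; field; rewrite !gt_eqF.
  (* The violated inequality replaces the usages by [(1 + eta) t] times the cost, and weak duality
     replaces [t V] by [D]. The potential then grows by a factor [1 + X <= exp X]. *)
  have h1 : eta / v * (\sum_i y i * usage (xs l) i)
      <= D * (eta * (1 + eta) * (v^-1 * cost (xs l)) / V).
    apply: (@le_trans _ _ (eta / v * ((1 + eta) * t * cost (xs l)))).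
      by rewrite ler_wpM2l ?divr_ge0 ?(ltW v0) ?(ltW eta0) // ltW.
    have -> : eta / v * ((1 + eta) * t * cost (xs l))
        = (t * V) * (eta * (1 + eta) * (v^-1 * cost (xs l)) / V).
      by field; rewrite !gt_eqF.
    apply: ler_wpM2r dual; rewrite divr_ge0 ?(ltW V0) //.
    rewrite mulr_ge0 //; first by rewrite mulr_ge0; lra.
    by rewrite mulr_ge0 ?invr_ge0 // ltW.
  set X := eta * _ * _ / V in h1.
  apply: (@le_trans _ _ (D * (1 + X))); first by rewrite mulrDr mulr1 lerD2l.
  have D0 : 0 <= D by apply: sumr_ge0 => i _; rewrite mulr_ge0 // ltW.
  apply: (le_trans (ler_wpM2l D0 (expR_ge1Dx X))).
  rewrite dotDZ.
  have -> : eta * (1 + eta) * (cost z + v^-1 * cost (xs l)) / V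
      = eta * (1 + eta) * cost z / V + X by rewrite /X; ring.
  rewrite expRD mulrA; apply: ler_wpM2r (gk_potential I V0); exact: expR_ge0.
- move=> i; rewrite loadD mulrDr expRD mulrA.
  apply: ler_pM; [exact: expR_ge0|exact: expR_ge0|exact: gk_exp_load I i|].
  exact: expR_ln1D_le.
- move=> i; rewrite mulrA -(natr1 f) (mulrDr eta f%:R) mulr1 expRD.
  apply: ler_pM; [|by rewrite addr_ge0 // ew0|exact: gk_upper I i|].
    by rewrite mulr_ge0 // ltW.
  apply: le_trans (expR_ge1Dx _); rewrite lerD2l; apply: ler_piMr.
    exact: ltW.
  by case/andP: (w01 i).
- rewrite -(natr1 f); under eq_bigr do rewrite loadD.
  rewrite big_split /= lerD ?(gk_count I) // (bigD1 i0) //=.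
  (* The row attaining the maximal load alone raises the total load by 1. *)
  have -> : w i0 = 1 by rewrite /w -vi0 divff // gt_eqF.
  by rewrite lerDl; apply: sumr_ge0.
Qed.

(** At the generator attaining [lamstar], [gk_upper] gives [t <= exp (eta f) lamstar / delta], while
    [t = lam (1 + eta)^g] and [lamstar <= m^(m/eps) lam]. Taking logarithms, with
    [ln (1 + eta) >= eta/2], bounds [g]. *)
Lemma gk_raises_bound y z t f g : gk_inv y z t f g ->
  g%:R <= 2 * f%:R + 40 * ((eps ^+ 2)^-1 * (m%:R * log_factor R m)).
Proof.
move=> I; have [[l cl lamE] _] := lamstarP.
have m0 : 0 < m%:R :> R by rewrite ltr0n m_gt0.
have m1 : 1 <= m%:R :> R by rewrite ler1n m_gt0.
have eta0 : 0 < eta by have := eps_gt0; lra.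
have eta1 : 0 < 1 + eta by lra.
have l0 := lam_gt0.
have ltS : t <= expR (eta * f%:R) * (lamstar / delta).
  rewrite -(ler_pM2r cl) lamE dot_gk_length.
  apply: (le_trans (gk_lower I l)).
  have -> : expR (eta * f%:R) * (delta * (\sum_i load (xs l) i) / cost (xs l) / delta)
      * cost (xs l) = expR (eta * f%:R) * \sum_i load (xs l) i.
    by field; rewrite !gt_eqF.
  rewrite mulr_sumr; apply: ler_sum => i _.
  have -> : y i * usage (xs l) i = (b i 0)%:R * y i * load (xs l) i.
    by rewrite /load; field; rewrite gt_eqF.
  by apply: ler_wpM2r (gk_upper I i); apply: load_ge0.
have pow_gt0 : 0 < (1 + eta) ^+ g by apply: exprn_gt0.
have P_gt0 : 0 < m%:R `^ (eps^-1 * m%:R) by apply: powR_gt0.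
have dV_gt0 : 0 < delta^-1 by rewrite invr_gt0.
have pow_le : (1 + eta) ^+ g
    <= expR (eta * f%:R) * (m%:R `^ (eps^-1 * m%:R) * delta^-1).
  rewrite -(ler_pM2l l0) -(gk_t I); apply: (le_trans ltS).
  have /andP[_ le] := lamP.
  have -> : lam * (expR (eta * f%:R) * (m%:R `^ (eps^-1 * m%:R) * delta^-1))
      = expR (eta * f%:R) * ((m%:R `^ (eps^-1 * m%:R)) * lam / delta) by ring.
  by apply: ler_wpM2l; [exact: expR_ge0|apply: ler_wpM2r; [exact: ltW|]].
move: pow_le; rewrite -ler_ln ?posrE ?mulr_gt0 ?expR_gt0 //.
rewrite lnXn // lnM ?posrE ?mulr_gt0 ?expR_gt0 // lnM ?posrE // expRK ln_powR.
rewrite -[_ *+ g]mulr_natl => main.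
have dle := ln_gk_deltaV m_gt0 eps_gt0 eps_lt1.
have lnle := @ln_le_log_factor R m; have LF1 := log_factor_ge1 R m.
have ln_m0 : 0 <= ln m%:R :> R by apply: ln_ge0.
set LF := log_factor R m in lnle LF1 *; set lm := ln m%:R in main dle lnle ln_m0 *.
have e'0 : 0 < eps^-1 by rewrite invr_gt0.
have ln1 : eta / 2 <= ln (1 + eta).
  apply: le_trans (ln1D_ge eta0); rewrite ler_pM2l // lef_pV2 ?posrE //.
  by have := eps_lt1; lra.
have g0 : 0 <= g%:R :> R by [].
have h1 := ler_wpM2l g0 ln1.
have h2 : eps^-1 * m%:R * lm <= eps^-1 * (m%:R * LF).
  by rewrite -mulrA ler_pM2l // ler_pM2l.
have h3 : 2 / eps * (1 + lm) <= eps^-1 * (4 * (m%:R * LF)).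
  rewrite [2 / eps]mulrC -mulrA ler_pM2l //.
  have : LF <= m%:R * LF by rewrite ler_peMl //; lra.
  by lra.
have h4 : g%:R * (eta / 2) <= eta * f%:R + eps^-1 * (5 * (m%:R * LF)).
  apply: (le_trans h1); apply: (le_trans main); rewrite lerD2l.
  have -> : eps^-1 * (5 * (m%:R * LF))
      = eps^-1 * (m%:R * LF) + eps^-1 * (4 * (m%:R * LF)) by ring.
  exact: lerD h2 (le_trans dle h3).
have eta20 : 0 < eta / 2 by lra.
(* Division by [eta / 2 = eps / 8] turns the constant 5 into 40. *)
move: h4; rewrite -ler_pdivlMr // => h4; apply: (le_trans h4).
rewrite le_eqVlt; apply/orP; left; apply/eqP.
by field; rewrite gt_eqF.
Qed.

(** Division by the maximal load restores feasibility. In a row of load [M], [gk_exp_load] bounds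
    the potential from below, against [gk_potential] from above. *)
Lemma gk_final y z t f g M r :
  gk_inv y z t f g -> ln m%:R <= r -> 0 < r ->
  m%:R * (r / (eta * eta)) <= f%:R ->
  (forall i, load z i <= M) -> (M = 0 \/ exists i, M = load z i) ->
  approx_solution A b c xs eps (M^-1 *: z).
Proof.
move=> I lnr r0 hf Mmax Matt.
have m0 : 0 < m%:R :> R by rewrite ltr0n m_gt0.
have eta0 : 0 < eta by have := eps_gt0; lra.
have eta1 : 4 * eta < 1 by have := eps_lt1; lra.
(* Averaging: the total load is at least [f], so the largest of the [m] loads is at least
   [f / m]. *)
have M_ge : r / (eta * eta) <= M.
  rewrite -(ler_pM2l m0); apply: (le_trans hf); apply: (le_trans (gk_count I)).
  apply: (@le_trans _ _ (\sum_(i < m) M)); first by apply: ler_sum.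
  by rewrite sumr_const card_ord mulr_natl.
have M0 : 0 < M by apply: lt_le_trans M_ge; rewrite divr_gt0 // mulr_gt0.
have {Matt} [i0 Mi0] : exists i, M = load z i.
  by case: Matt => // M00; rewrite M00 ltxx in M0.
split.
  split.
    have [al [al0 ->]] := gk_cone I; exists (fun l => M^-1 * al l); split.
      by move=> l; rewrite mulr_ge0 // invr_ge0 ltW.
    by rewrite scaler_sumr; apply: eq_bigr => l _; rewrite scalerA.
  move=> i; rewrite -/(usage _ i) usageZ ler_pdivrMl //.
  by have := Mmax i; rewrite /load ler_pdivrMr.
rewrite dotZ.
have [V0|V0] := leP V 0.
  apply: (@le_trans _ _ 0).
    by rewrite mulr_ge0_le0 //; have := eps_lt1; lra.
  by rewrite mulr_ge0 ?invr_ge0 ?(gk_cost I) // ltW.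
set Q := cost z / V.
have key : ln (1 + eta) * M <= ln m%:R + eta * (1 + eta) * Q.
  rewrite -ler_expR expRD lnK ?posrE // [eta * (1 + eta) * Q]mulrA.
  apply: le_trans (gk_potential I V0); rewrite Mi0.
  apply: (le_trans (gk_exp_load I i0)); rewrite (bigD1 i0) //= lerDl.
  by apply: sumr_ge0 => i _; rewrite mulr_ge0 // ltW // (gk_dual_gt0 I).
move: M_ge; rewrite ler_pdivrMr; last exact: mulr_gt0.
move=> M_ge.
have lnL : eta - eta * eta <= ln (1 + eta).
  apply: le_trans (ln1D_ge eta0); rewrite ler_pdivlMr; last by lra.
  have -> : (eta - eta * eta) * (1 + eta) = eta - eta * (eta * eta) by ring.
  by have := mulr_gt0 eta0 (mulr_gt0 eta0 eta0); rewrite gerBl => /ltW.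
have h1 := ler_wpM2r (ltW M0) lnL.
(* Here [ln m <= r <= eta^2 M], so the logarithm costs one more [eta^2 M] beside the one lost in
   [lnL]. *)
have h2 : eta * ((1 - 2 * eta) * M) <= eta * ((1 + eta) * Q) by lra.
rewrite ler_pM2l // in h2.
(* Since [4 eta = eps], this produces the factor [1 - eps]. *)
have h3 : (1 + eta) * ((1 - 4 * eta) * M) <= (1 - 2 * eta) * M.
  rewrite [leLHS]mulrA; apply: ler_wpM2r; first exact: ltW.
  by have := mulr_gt0 eta0 eta0; lra.
have {h2 h3} := le_trans h3 h2; rewrite ler_pM2l; last by lra.
rewrite /Q ler_pdivlMr // => h.
rewrite ler_pdivlMl //; apply: le_trans h.
by rewrite le_eqVlt; apply/orP; left; apply/eqP; field.
Qed.

End Packing.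

(** * The program *)

(* Memory layout.  Nat arrays: 3 loop counter, 4 oracle verdict, 5 power of 2.
   Real arrays: 4 z, 5 y, 6 query vector, 7 generator found, 8 usages,
   9 maximal load, 10 lower bound t, 11 number of packing steps,
   12 required number of packing steps, 13 rounded log m, 14 eta. *)
Definition ncell a := NGet a (NConst 0).
Definition rcell a := RGet a (NConst 0).
Definition rcur a := RGet a counter.

Definition measure (src : nat) : cmd :=
  Seq (for_ 0 (RSet 8 counter (RConst 0)))
 (Seq (for_ 2 (RSet 8 (NGet 1 counter)
         (RAdd (RGet 8 (NGet 1 counter))
               (RMul (rcur 1) (RGet src (NGet 2 counter))))))
 (Seq (RSet 9 (NConst 0) (RConst 0))
      (for_ 0 (If (TRLt (rcell 9) (RDiv (rcur 8) (rcur 2)))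
                  (RSet 9 (NConst 0) (RDiv (rcur 8) (rcur 2))) Skip)))).

Definition price : cmd :=
  Seq (for_ 1 (RSet 6 counter
         (RSub (RConst 0)
               (RMul (RMul (RAdd (RConst 1) (rcell 14)) (rcell 10)) (rcur 3)))))
      (for_ 2 (RSet 6 (NGet 2 counter)
         (RAdd (RGet 6 (NGet 2 counter))
               (RMul (rcur 1) (RGet 5 (NGet 1 counter)))))).

Definition pack : cmd :=
  Seq (measure 7)
 (Seq (for_ 1 (RSet 4 counter (RAdd (rcur 4) (RDiv (rcur 7) (rcell 9)))))
 (Seq (for_ 0 (RSet 5 counter (RMul (rcur 5)
         (RAdd (RConst 1)
               (RMul (rcell 14) (RDiv (RDiv (rcur 8) (rcur 2)) (rcell 9)))))))
      (RSet 11 (NConst 0) (RAdd (rcell 11) (RConst 1))))).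

Definition main_body : cmd :=
  Seq price
 (Seq (Query 6 4 7)
      (If (TNLt (NConst 0) (ncell 4)) pack
          (RSet 10 (NConst 0) (RMul (RAdd (RConst 1) (rcell 14)) (rcell 10))))).

Definition log_body : cmd :=
  Seq (NSet 5 (NConst 0) (NAdd (ncell 5) (ncell 5)))
      (RSet 13 (NConst 0) (RAdd (rcell 13) (RConst 1))).

(** Without logarithms or conversions from naturals to reals, [ln m] is bounded by counting
    doublings in a real cell, and the target [m r / eta^2] is built by [m] additions. *)
Definition prologue : cmd :=
  Seq (RSet 14 (NConst 0) (RDiv (rcell 0) (RConst 4)))
 (Seq (RSet 10 (NConst 0) (RGet 0 (NConst 1)))
 (Seq (NSet 5 (NConst 0) (NConst 1))
 (Seq (RSet 13 (NConst 0) (RConst 1))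
 (Seq (While (TNLt (ncell 5) (ncell 0)) log_body)
 (Seq (for_ 0 (RSet 12 (NConst 0)
         (RAdd (rcell 12) (RDiv (rcell 13) (RMul (rcell 14) (rcell 14))))))
      (for_ 0 (RSet 5 counter (RDiv (RConst 1) (rcur 2))))))))).

Definition epilogue : cmd :=
  Seq (measure 4) (for_ 1 (RSet 4 counter (RDiv (rcur 4) (rcell 9)))).

Definition packing_program : cmd :=
  Seq prologue (Seq (While (TRLt (rcell 11) (rcell 12)) main_body) epilogue).

(** * Sums over the sparse representation of the matrix *)

Section Sparse.
Variables (R : realType) (m n : nat) (A : 'M[nat]_(m, n)).
Local Notation nz := (nonzeros A).

Lemma mem_nonzeros p : (p \in nz) = (0 < A p.1 p.2)%N.
Proof. by rewrite /nonzeros mem_filter mem_enum inE andbT lt0n. Qed.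

(** The nonzero positions project onto all rows. Loops over rows can therefore be charged to the
    number of nonzero entries. *)
Lemma leq_rows_nonzeros : (forall i, exists j, (0 < A i j)%N) -> (m <= size nz)%N.
Proof.
move=> h; rewrite -{1}(size_enum_ord m) -(size_map fst).
apply: uniq_leq_size => [|i _]; first exact: enum_uniq.
by have [j Aij] := h i; apply/mapP; exists (i, j); rewrite ?mem_nonzeros.
Qed.

Lemma leq_cols_nonzeros : (forall j, exists i, (0 < A i j)%N) -> (n <= size nz)%N.
Proof.
move=> h; rewrite -{1}(size_enum_ord n) -(size_map snd).
apply: uniq_leq_size => [|j _]; first exact: enum_uniq.
by have [i Aij] := h j; apply/mapP; exists (i, j); rewrite ?mem_nonzeros.
Qed.

Lemma sum_nonzeros (P : pred ('I_m * 'I_n)) (F : 'I_m * 'I_n -> R) :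
  (forall p, A p.1 p.2 = 0%N -> F p = 0) ->
  \sum_(p <- nz | P p) F p = \sum_i \sum_(j | P (i, j)) F (i, j).
Proof.
move=> F0; rewrite big_filter_cond big_enum_cond /=.
under [RHS]eq_bigr do rewrite big_mkcond.
rewrite pair_bigA big_mkcond; apply: eq_bigr => -[i j] _ /=.
rewrite inE /=; case: eqP => [A0|_] //=; rewrite F0 //.
by case: ifP.
Qed.

Lemma nth_map_tnth (U : Type) (W : Type) (w0 : W) (g : U -> W) (s : seq U)
  (e : 'I_(size s)) : nth w0 (map g s) e = g (tnth (in_tuple s) e).
Proof.
set u := tnth _ _; rewrite (nth_map u) //; congr (g _).
by rewrite [RHS](tnth_nth u).
Qed.

(** Identifies what a scatter loop accumulates in cell [i] with an entry of the dense matrix-vector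
    product. *)
Lemma sparse_row_sum (z : nat -> R) (i : 'I_m) :
  \sum_(e < size nz | nth 0%N [seq val p.1 | p <- nz] e == i)
     nth 0 [seq (A p.1 p.2)%:R | p <- nz] e * z (nth 0%N [seq val p.2 | p <- nz] e)
  = \sum_j (A i j)%:R * z j.
Proof.
under eq_bigr do rewrite !nth_map_tnth.
under eq_bigl do rewrite nth_map_tnth.
rewrite -(big_tnth _ _ nz (fun p => val p.1 == i)
  (fun p => (A p.1 p.2)%:R * z (val p.2))).
rewrite sum_nonzeros; last by move=> p ->; rewrite mul0r.
rewrite (bigD1 i) //= [X in _ + X]big1 => [|i' /negPf ne].
  by rewrite addr0; apply: eq_big => j //=; rewrite eqxx.
by rewrite big_pred0 // => j; rewrite val_eqE ne.
Qed.

Lemma sparse_col_sum (y : nat -> R) (j : 'I_n) :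
  \sum_(e < size nz | nth 0%N [seq val p.2 | p <- nz] e == j)
     nth 0 [seq (A p.1 p.2)%:R | p <- nz] e * y (nth 0%N [seq val p.1 | p <- nz] e)
  = \sum_i (A i j)%:R * y i.
Proof.
under eq_bigr do rewrite !nth_map_tnth.
under eq_bigl do rewrite nth_map_tnth.
rewrite -(big_tnth _ _ nz (fun p => val p.2 == j)
  (fun p => (A p.1 p.2)%:R * y (val p.1))).
rewrite sum_nonzeros; last by move=> p ->; rewrite mul0r.
by apply: eq_bigr => i _; rewrite (big_pred1 j) // => j'; rewrite /= val_eqE.
Qed.

End Sparse.

(** * Correctness and running time of the program *)

Section Correctness.
Variables (R : realType) (m n k : nat).
Variables (A : 'M[nat]_(m, n)) (b : 'cV[nat]_m) (c : 'cV[int]_n).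
Variables (xs : 'I_k -> 'cV[R]_n) (eps lam lamstar : R).
Variables (orc : 'cV[R]_n -> option 'cV[R]_n) (T : nat).
Hypotheses (rowA : forall i, exists j, (0 < A i j)%N)
  (colA : forall j, exists i, (0 < A i j)%N)
  (b_gt0 : forall i, (0 < b i 0%R)%N)
  (xs_pos : forall l, xs l != 0 /\ forall j, 0 <= xs l j 0)
  (eps01 : 0 < eps < 1)
  (orcP : separation_oracle xs orc)
  (lamstarP : is_min_ratio A b c xs eps lamstar)
  (lamP : lam <= lamstar <= (m%:R `^ (eps^-1 * m%:R)) * lam).

Implicit Types s : state R.
Local Notation N := (size (nonzeros A)).
Local Notation s0 := (init_state A b c eps lam).
Local Notation runs := (runs orc T).
Local Notation eta := (eps / 4).

Definition inputs_ok s : Prop :=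
  (forall a, (a < 3)%N -> nmem s a = nmem s0 a) /\
  (forall a, (a < 4)%N -> rmem s a = rmem s0 a).

Lemma inputs_frame p s s' : frame p s s' ->
  all (leq 3) (nwrites p) -> all (leq 4) (rwrites p) ->
  inputs_ok s -> inputs_ok s'.
Proof.
move=> [f1 f2] /allP h1 /allP h2 [i1 i2]; split=> a lta.
  rewrite f1 ?i1 //; apply/negP => /h1; lia.
rewrite f2 ?i2 //; apply/negP => /h2; lia.
Qed.

Lemma leq_m_nonzeros : (m <= N)%N. Proof. exact: leq_rows_nonzeros. Qed.
Lemma leq_n_nonzeros : (n <= N)%N. Proof. exact: leq_cols_nonzeros. Qed.
Lemma nonzeros_gt0 : (0 < N)%N.
Proof. exact: leq_trans (m_gt0 colA b_gt0 xs_pos lamstarP) leq_m_nonzeros. Qed.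

Lemma vec_cells_ord p (z : 'cV[R]_p) (i : 'I_p) : vec_cells z i = z i 0.
Proof. by rewrite /vec_cells insubT //= => h; congr (z _ 0); apply: val_inj. Qed.

Lemma b_cell (i : 'I_m) : rmem s0 2 i = (b i 0)%:R.
Proof. by rewrite /= vec_cells_ord mxE. Qed.

Lemma c_cell (j : 'I_n) : rmem s0 3 j = cost_vec R c j 0.
Proof. by rewrite /= vec_cells_ord. Qed.

Lemma it_inputs s j s1 : inputs_ok s -> in_iteration s j s1 ->
  (forall a, (a < 3)%N -> nmem s1 a = nmem s0 a) /\ nmem s1 3 0%N = j.
Proof.
move=> [i1 _] [h1 h2]; split=> // a lta; rewrite h1 ?i1 //.
by apply/eqP => e; rewrite e in lta.
Qed.

(** Arrays 8 and 9 are overwritten, so the source must be another one. The row loops fit the budget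
    because [m <= N]. *)
Lemma runs_measure src s : inputs_ok s -> src \notin [:: 8; 9]%N ->
  runs (measure src) s (200 * N) (fun s' =>
    [/\ forall i : 'I_m, rmem s' 8 i = usage A (get_vec n s src) i,
        forall i, load A b (get_vec n s src) i <= rmem s' 9 0%N
      & rmem s' 9 0%N = 0 \/
        exists i, rmem s' 9 0%N = load A b (get_vec n s src) i]).
Proof.
move=> ok; rewrite !inE negb_or => /andP[src8 src9].
have m_le := leq_m_nonzeros; have N0 := nonzeros_gt0.
apply: (@runs_weaken _ _ _ _ _ _ (26 * N + (50 * N + (4 * N + 60 * N)))%N); last first.
- by move=> s' _ h; exact: h.
- by lia.
apply: (runs_seq (Q1 := fun s' => forall i, (i < m)%N -> rmem s' 8 i = 0)).
  apply: (@runs_weaken _ _ _ _ _ _ _ _ _ _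
    (@runs_map _ _ orc T 0 8 (RConst 0) (fun=> 0) s _)).
  + by [].
  + by rewrite ok.1 //=; lia.
  + by move=> s' _ h i lti; apply: h; rewrite ok.1.
move=> s1 fr1 z1; have ok1 := inputs_frame fr1 isT isT ok.
apply: (runs_seq (Q1 := fun s' => forall i : 'I_m,
    rmem s' 8 i = usage A (get_vec n s src) i)).
  apply: (@runs_weaken _ _ _ _ _ _ _ _ _ _ (@runs_scatter _ _ orc T 2 8 (NGet 1 counter)
    (RMul (rcur 1) (RGet src (NGet 2 counter)))
    (nmem s0 1) (fun e => rmem s0 1 e * rmem s src (nmem s0 2 e)) s1 _ _)).
  + by move=> j s2 ltj /(it_inputs ok1)[h1 h2] /=; rewrite h2 h1.
  + move=> j s2 ltj /(it_inputs ok1)[h1 h2] fr2 /=; rewrite h2 !h1 //.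
    by rewrite (fr2 1%N) // (ok1.2 1%N) // fr2 // fr1.2 // inE.
  + by rewrite ok1.1 //=; lia.
  + move=> s' _ h i; rewrite h z1 // add0r ok1.1 //=.
    rewrite (sparse_row_sum A (rmem s src) i); apply: eq_bigr => j _.
    by rewrite mxE.
move=> s2 fr2 u2; have ok2 := inputs_frame fr2 isT isT ok1.
apply: (runs_seq (Q1 := fun s' => rmem s' 9 0%N = 0 /\ rmem s' 8 = rmem s2 8)).
  by apply: runs_rset => /=; [lia|split].
move=> s3 fr3 [z3 e3]; have ok3 := inputs_frame fr3 isT isT ok2.
apply: (@runs_weaken _ _ _ _ _ _ _ _ _ _ (@runs_max _ _ orc T 0 9
  (RDiv (rcur 8) (rcur 2)) (fun i => rmem s2 8 i / rmem s0 2 i) s3 _ z3)).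
- move=> j s4 ltj /(it_inputs ok3)[h1 h2] fr4 /=; rewrite h2.
  by rewrite (fr4 8%N) // (fr4 2%N) // (ok3.2 2%N) // e3.
- by rewrite ok3.1 //=; lia.
move=> s4 fr4; rewrite ok3.1 //= => -[_ h1 h2].
have e4 : rmem s4 8 = rmem s2 8 by rewrite fr4.2.
have ld (i : 'I_m) : rmem s2 8 i / rmem s0 2 i = load A b (get_vec n s src) i.
  by rewrite u2 b_cell.
split.
- by move=> i; rewrite e4 u2.
- by move=> i; rewrite -ld; apply: h1.
- case: h2 => [|[j ltj ->]]; [by left|right].
  by exists (Ordinal ltj); rewrite -ld.
Qed.

Definition duals s (i : 'I_m) : R := rmem s 5 i.

Lemma runs_price s : inputs_ok s -> rmem s 14 0%N = eta ->
  runs price s (100 * N) (fun s' =>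
    get_vec n s' 6 = reduced A c (duals s) ((1 + eta) * rmem s 10 0%N)).
Proof.
move=> ok eta_s; have n_le := leq_n_nonzeros; have N0 := nonzeros_gt0.
apply: (@runs_weaken _ _ _ _ _ _ (50 * N + 50 * N)%N); last first.
- by move=> s' _ h; exact: h.
- by lia.
pose F j : R := - ((1 + eta) * rmem s 10 0%N * rmem s0 3 j).
apply: (runs_seq (Q1 := fun s' => forall j, (j < n)%N -> rmem s' 6 j = F j)).
  apply: (@runs_weaken _ _ _ _ _ _ _ _ _ _ (@runs_map _ _ orc T 1 6 _ F s _)).
  + move=> j s2 ltj /(it_inputs ok)[h1 h2] _ fr2 /=.
    by rewrite h2 (fr2 14%N) // (fr2 10%N) // (fr2 3%N) // eta_s (ok.2 3%N) // sub0r.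
  + by rewrite ok.1 //=; lia.
  + by move=> s' _ h i lti; apply: h; rewrite ok.1.
move=> s1 fr1 z1; have ok1 := inputs_frame fr1 isT isT ok.
apply: (@runs_weaken _ _ _ _ _ _ _ _ _ _ (@runs_scatter _ _ orc T 2 6 (NGet 2 counter)
    (RMul (rcur 1) (RGet 5 (NGet 1 counter)))
    (nmem s0 2) (fun e => rmem s0 1 e * rmem s 5 (nmem s0 1 e)) s1 _ _)).
- by move=> j s2 ltj /(it_inputs ok1)[h1 h2] /=; rewrite h2 h1.
- move=> j s2 ltj /(it_inputs ok1)[h1 h2] fr2 /=; rewrite h2 !h1 //.
  by rewrite (fr2 1%N) // (ok1.2 1%N) // fr2 // fr1.2.
- by rewrite ok1.1 //=; lia.
- move=> s' _ h; apply/colP => j; rewrite !mxE h z1 // /F c_cell ok1.1 //=.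
  by rewrite (sparse_col_sum A (rmem s 5) j) addrC [cost_vec _ _ _ _]mxE.
Qed.

Local Notation inv := (gk_inv A b c xs eps lam).

(** Arrays 4 and 5 receive exactly the update of [gk_inv_step], with the measured maximal load as
    [v]. *)
Lemma runs_pack s f g l : inputs_ok s -> rmem s 14 0%N = eta ->
  rmem s 11 0%N = f%:R ->
  inv (duals s) (get_vec n s 4) (rmem s 10 0%N) f g ->
  get_vec n s 7 = xs l ->
  dot (reduced A c (duals s) ((1 + eta) * rmem s 10 0%N)) (xs l) < 0 ->
  runs pack s (400 * N) (fun s' => rmem s' 11 0%N = f.+1%:R /\
    inv (duals s') (get_vec n s' 4) (rmem s' 10 0%N) f.+1 g).
Proof.
move=> ok eta_s cnt I xl neg.
have n_le := leq_n_nonzeros; have m_le := leq_m_nonzeros; have N0 := nonzeros_gt0.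
apply: (@runs_weaken _ _ _ _ _ _ (200 * N + (50 * N + (50 * N + 20 * N)))%N); last first.
- by move=> s' _ h; exact: h.
- by lia.
apply: runs_seq; first exact: (@runs_measure 7).
rewrite xl => s1 fr1 [u1 max1 att1]; have ok1 := inputs_frame fr1 isT isT ok.
set v := rmem s1 9 0%N in max1 att1.
apply: (runs_seq (Q1 := fun s' => forall j, (j < n)%N ->
    rmem s' 4 j = rmem s 4 j + rmem s 7 j / v)).
  apply: (@runs_weaken _ _ _ _ _ _ _ _ _ _ (@runs_map _ _ orc T 1 4 _
    (fun j => rmem s 4 j + rmem s 7 j / v) s1 _)).
  + move=> j s2 ltj /(it_inputs ok1)[h1 h2] e4 fr2 /=.
    by rewrite h2 e4 (fr2 7%N) // (fr2 9%N) // (fr1.2 4%N) // (fr1.2 7%N).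
  + by rewrite ok1.1 //=; lia.
  + by move=> s' _ h i lti; apply: h; rewrite ok1.1.
move=> s2 fr2 z2; have ok2 := inputs_frame fr2 isT isT ok1.
pose F i := rmem s 5 i * (1 + eta * (rmem s1 8 i / rmem s0 2 i / v)).
apply: (runs_seq (Q1 := fun s' => forall i, (i < m)%N -> rmem s' 5 i = F i)).
  apply: (@runs_weaken _ _ _ _ _ _ _ _ _ _ (@runs_map _ _ orc T 0 5 _ F s2 _)).
  + move=> j s3 ltj /(it_inputs ok2)[h1 h2] e5 fr3 /=.
    rewrite h2 e5 (fr3 14%N) // (fr3 8%N) // (fr3 2%N) // (fr3 9%N) // (ok2.2 2%N) //.
    rewrite !(fr2.2 5%N) // !(fr2.2 14%N) // !(fr2.2 8%N) // !(fr2.2 9%N) //.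
    by rewrite (fr1.2 5%N) // (fr1.2 14%N) // eta_s.
  + by rewrite ok2.1 //=; lia.
  + by move=> s' _ h i lti; apply: h; rewrite ok2.1.
move=> s3 fr3 y3.
apply: runs_rset; first by rewrite /=; lia.
have -> : f.+1%:R = f%:R + 1 :> R by rewrite natr1.
split.
  by rewrite /= /update /= (fr3.2 11%N) // (fr2.2 11%N) // (fr1.2 11%N) // cnt.
have -> : duals (set_real s3 11 (neval s3 (NConst 0))
    (reval s3 (RAdd (rcell 11) (RConst 1))))
    = (fun i => duals s i * (1 + eta * (load A b (xs l) i / v))).
  apply/funext => i; rewrite /duals /= /update /= y3 // /F u1.
  by rewrite b_cell.
have -> : get_vec n (set_real s3 11 (neval s3 (NConst 0))
    (reval s3 (RAdd (rcell 11) (RConst 1)))) 4 = get_vec n s 4 + v^-1 *: xs l.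
  apply/colP => j; rewrite -xl !mxE /= /update /= (fr3.2 4%N) // z2 //.
  by rewrite mulrC.
rewrite /= /update /= (fr3.2 10%N) // (fr2.2 10%N) // (fr1.2 10%N) //.
exact: (gk_inv_step colA b_gt0 xs_pos eps01 lamstarP lamP I neg max1 att1).
Qed.

(** Each iteration either packs or raises [t], so the iteration count is [f + g]. A packing step
    starts with [f] below [tgt], hence the slack of 1. *)
Definition loop_inv (tgt : R) (j : nat) s : Prop :=
  [/\ inputs_ok s, rmem s 14 0%N = eta, rmem s 12 0%N = tgt &
    exists f g, [/\ (f + g)%N = j, rmem s 11 0%N = f%:R, f%:R <= tgt + 1 &
      inv (duals s) (get_vec n s 4) (rmem s 10 0%N) f g]].

Lemma runs_main_body tgt j s : loop_inv tgt j s ->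
  rmem s 11 0%N < rmem s 12 0%N ->
  runs main_body s (600 * N + T) (loop_inv tgt j.+1).
Proof.
move=> [ok eta_s tgt_s [f [g [fg cnt ftgt I]]]]; rewrite cnt tgt_s => flt.
have N0 := nonzeros_gt0.
apply: (@runs_weaken _ _ _ _ _ _ (100 * N + (T.+1 + (410 * N)))%N); last first.
- by move=> s' _ h; exact: h.
- by lia.
apply: runs_seq; first exact: (runs_price ok eta_s).
move=> s1 fr1 d1; have ok1 := inputs_frame fr1 isT isT ok.
apply: (runs_seq (Q1 := fun s2 => s2 = answer orc s1 6 4 7)).
  by apply: runs_query.
move=> s2 fr2 s2E; have ok2 := inputs_frame fr2 isT isT ok1.
have eq a : a \notin [:: 6; 7]%N -> rmem s2 a = rmem s a.
  by rewrite !inE negb_or => /andP[h6 h7];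
    rewrite fr2.2 ?fr1.2 // !inE ?orbF ?(negPf h6).
have dE : duals s2 = duals s by apply/funext => i; rewrite /duals eq.
have zE : get_vec n s2 4 = get_vec n s 4 by apply/colP => i; rewrite !mxE eq.
have I2 : inv (duals s2) (get_vec n s2 4) (rmem s2 10 0%N) f g.
  by rewrite dE zE eq.
have eta_2 : rmem s2 14 0%N = eta by rewrite eq.
have cnt2 : rmem s2 11 0%N = f%:R by rewrite eq.
have tgt2 : rmem s2 12 0%N = tgt by rewrite eq.
apply: (runs_if (B := (400 * N)%N)); first by rewrite /=; lia.
have := orcP (get_vec n s1 6); move: s2E; rewrite /answer d1.
case: (orc _) => [x|] s2E.
- move=> [l xE neg].
  have -> : teval s2 (TNLt (NConst 0) (ncell 4)) = true by rewrite s2E /= /update.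
  have x7 : get_vec n s2 7 = xs l.
    rewrite -xE s2E; apply/colP => i; rewrite !mxE /=.
    by rewrite insubT //= => h; congr (x _ 0); apply: val_inj.
  have neg2 : dot (reduced A c (duals s2) ((1 + eta) * rmem s2 10 0%N)) (xs l) < 0.
    by rewrite dE eq.
  apply: (@runs_weaken _ _ _ _ _ _ _ _ _ _ (runs_pack ok2 eta_2 cnt2 I2 x7 neg2)) => //.
  move=> s3 fr3 [cnt3 I3]; split.
  + exact: (inputs_frame fr3).
  + by rewrite fr3.2.
  + by rewrite fr3.2.
  + exists f.+1, g; split=> //; first by rewrite addSn fg.
    by rewrite -natr1 lerD2r ltW.
- move=> pos.
  have -> : teval s2 (TNLt (NConst 0) (ncell 4)) = false by rewrite s2E /= /update.
  apply: (@runs_weaken _ _ _ _ _ _ (400 * N)%N _ (fun s3 =>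
    rmem s3 10 0%N = (1 + eta) * rmem s2 10 0%N)) => //.
    by apply: runs_rset; [rewrite /=; lia|rewrite /= /update /= eta_2].
  move=> s3 fr3 t3; split.
  + exact: (inputs_frame fr3).
  + by rewrite fr3.2.
  + by rewrite fr3.2.
  + exists f, g.+1; split=> //; first by rewrite addnS fg.
      by rewrite fr3.2.
    have -> : duals s3 = duals s2 by apply/funext => i; rewrite /duals fr3.2.
    have -> : get_vec n s3 4 = get_vec n s2 4 by apply/colP => i; rewrite !mxE fr3.2.
    rewrite t3; apply: gk_inv_raise I2 _ => l.
    by rewrite dE eq //; apply: pos.
Qed.

Local Notation LF := (log_factor R m).
Local Notation E := ((eps ^+ 2)^-1 * (m%:R * LF)).

(** After [j] doublings [r = j + 1]. The last passed test bounds [j] by [LF + 1], and on exit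
    [m <= 2^j] gives [ln m <= j ln 2 <= r]. *)
Lemma runs_log s : nmem s 0 0%N = m -> nmem s 5 0%N = 1%N -> rmem s 13 0%N = 1 ->
  runs (While (TNLt (ncell 5) (ncell 0)) log_body) s (Num.truncn (LF + 1) * 30 + 10)
    (fun s' => exists2 r, [/\ 0 < r, ln m%:R <= r & r <= 3 * LF] & rmem s' 13 0%N = r).
Proof.
move=> m_s p_s r_s; have LF1 := log_factor_ge1 R m.
(* The case [j = 0] is separate because [2 ^ 0 < m] fails when [m = 1]. *)
pose J j s1 := [/\ nmem s1 0 0%N = m, nmem s1 5 0%N = (2 ^ j)%N,
  rmem s1 13 0%N = j.+1%:R & j = 0%N \/ (2 ^ j.-1 < m)%N].
have JLF j s1 : J j s1 -> j%:R <= LF + 1.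
  case=> _ _ _ [->|/(@leq_expn_log_factor R)]; first by lra.
  by case: j => [|j] /=; rewrite -?natr1; lra.
apply: (@runs_weaken _ _ _ _ _ _ _ _ _ _ (@runs_while _ _ orc T
  (TNLt (ncell 5) (ncell 0)) log_body J 20 (Num.truncn (LF + 1)) s _ _ _)).
- by split=> //; left.
- by move=> j s1 /JLF le; rewrite truncn_ge_nat //; lra.
- move=> j s1 [m1 p1 r1 _] /=; rewrite p1 m1 => lt.
  apply: (@runs_weaken _ _ _ _ _ _ (10 + 10)%N _ (J j.+1)) => //.
  apply: (runs_seq (Q1 := fun s2 => nmem s2 5 0%N = (2 ^ j.+1)%N)).
    by apply: runs_nset => //=; rewrite /update /= p1 expnS; lia.
  move=> s2 fr2 p2; apply: runs_rset => //; split=> //=.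
  + by rewrite fr2.1.
  + by rewrite /update /= fr2.2 // r1 natr1.
  + by right.
- by rewrite /=; lia.
- move=> s' _ [j J1 nb]; exists j.+1%:R; last by case: J1.
  have le := JLF _ _ J1; case: J1 nb => m1 p1 r1 _ /=.
  rewrite m1 p1 -leqNgt => le_m; split=> //; last by rewrite -natr1; lra.
  have /andP[l2 l2'] := ln2_bounds R.
  have m0 := m_gt0 colA b_gt0 xs_pos lamstarP.
  apply: (@le_trans _ _ (ln (2 ^+ j))).
    rewrite ler_ln ?posrE ?ltr0n ?exprn_gt0 //.
    by rewrite -natrX ler_nat.
  rewrite lnXn // -[_ *+ j]mulr_natl -natr1.
  have : j%:R * ln 2 <= j%:R :> R by rewrite ler_piMr.
  by lra.
Qed.

Lemma runs_prologue :
  runs prologue s0 (Num.truncn (LF + 1) * 30 + 150 * N) (fun s' =>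
    exists2 r, [/\ 0 < r, ln m%:R <= r & r <= 3 * LF]
      & loop_inv (m%:R * (r / (eta * eta))) 0 s').
Proof.
have m_le := leq_m_nonzeros; have N0 := nonzeros_gt0.
apply: (@runs_weaken _ _ _ _ _ _ (6 + (6 + (6 + (6 +
  (Num.truncn (LF + 1) * 30 + 10 + (50 * N + 50 * N))))))%N); last first.
- by move=> s' _ h; exact: h.
- by lia.
have ok0 : inputs_ok s0 by [].
apply: (runs_seq (Q1 := fun s' => rmem s' 14 0%N = eta)).
  by apply: runs_rset.
move=> s1 fr1 e1; have ok1 := inputs_frame fr1 isT isT ok0.
apply: (runs_seq (Q1 := fun s' => rmem s' 10 0%N = lam)).
  by apply: runs_rset => //; rewrite /= /update /= fr1.2.
move=> s2 fr2 e2; have ok2 := inputs_frame fr2 isT isT ok1.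
apply: (runs_seq (Q1 := fun s' => nmem s' 5 0%N = 1%N)).
  by apply: runs_nset.
move=> s3 fr3 e3; have ok3 := inputs_frame fr3 isT isT ok2.
apply: (runs_seq (Q1 := fun s' => rmem s' 13 0%N = 1)).
  by apply: runs_rset.
move=> s4 fr4 e4; have ok4 := inputs_frame fr4 isT isT ok3.
apply: runs_seq.
  by apply: runs_log => //; [rewrite ok4.1|rewrite fr4.1].
move=> s5 fr5 [r rP r5]; have ok5 := inputs_frame fr5 isT isT ok4.
have eta5 : rmem s5 14 0%N = eta.
  by rewrite fr5.2 // fr4.2 // fr3.2 // fr2.2.
(* The packing, the step counter and the target rely on the zeros of the initial state. *)
have zero5 a : a \in [:: 4; 11; 12]%N -> rmem s5 a = fun=> 0.
  by rewrite !inE => /or3P[] /eqP->;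
    rewrite fr5.2 // fr4.2 // fr3.2 // fr2.2 // fr1.2.
apply: (runs_seq (Q1 := fun s' => rmem s' 12 0%N = m%:R * (r / (eta * eta)))).
  apply: (@runs_weaken _ _ _ _ _ _ _ _ _ _ (@runs_scatter _ _ orc T 0 12 (NConst 0)
    (RDiv (rcell 13) (RMul (rcell 14) (rcell 14))) (fun=> 0%N)
    (fun=> r / (eta * eta)) s5 _ _)).
  + by [].
  + by move=> j s6 _ _ fr6 /=; rewrite (fr6 13%N) // (fr6 14%N) // r5 eta5.
  + by rewrite ok5.1 //=; lia.
  + move=> s6 _ ->; rewrite zero5 // add0r ok5.1 //=.
    by rewrite sumr_const card_ord mulr_natl.
move=> s6 fr6 t6; have ok6 := inputs_frame fr6 isT isT ok5.
apply: (@runs_weaken _ _ _ _ _ _ _ _ _ _ (@runs_map _ _ orc T 0 5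
  (RDiv (RConst 1) (rcur 2)) (fun i => 1 / rmem s0 2 i) s6 _)).
- move=> j s7 ltj /(it_inputs ok6)[h1 h2] _ fr7 /=; rewrite h2.
  by rewrite (fr7 2%N) // ok6.2.
- by rewrite ok6.1 //=; lia.
move=> s7 fr7 y7; exists r => //; split.
- exact: (inputs_frame fr7).
- by rewrite fr7.2 // fr6.2.
- by rewrite fr7.2.
exists 0%N, 0%N; split=> //.
- by rewrite fr7.2 // fr6.2 // zero5.
- have [r0 _ _] := rP; have /andP[eps0 _] := eps01.
  rewrite addr_ge0 // mulr_ge0 // divr_ge0 ?(ltW r0) //.
  by rewrite mulr_ge0 // divr_ge0 // ltW.
- have -> : duals s7 = (fun i => 1 / (b i 0)%:R).
    apply/funext => i; rewrite /duals y7; first by rewrite b_cell.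
    by rewrite ok6.1 //=.
  have -> : get_vec n s7 4 = 0.
    by apply/colP => j; rewrite !mxE fr7.2 // fr6.2 // zero5.
  have -> : rmem s7 10 0%N = lam.
    by rewrite fr7.2 // fr6.2 // fr5.2 // fr4.2 // fr3.2.
  exact: (gk_inv_init colA b_gt0 xs_pos eps01 lamstarP lamP).
Qed.

Lemma runs_epilogue s r f g : inputs_ok s ->
  inv (duals s) (get_vec n s 4) (rmem s 10 0%N) f g ->
  0 < r -> ln m%:R <= r -> m%:R * (r / (eta * eta)) <= f%:R ->
  runs epilogue s (250 * N) (fun s' => approx_solution A b c xs eps (output n s')).
Proof.
move=> ok I r0 lnr hf; have n_le := leq_n_nonzeros; have N0 := nonzeros_gt0.
apply: (@runs_weaken _ _ _ _ _ _ (200 * N + 50 * N)%N); last first.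
- by move=> s' _ h; exact: h.
- by lia.
apply: runs_seq; first exact: (@runs_measure 4).
move=> s1 fr1 [_ max1 att1]; have ok1 := inputs_frame fr1 isT isT ok.
apply: (@runs_weaken _ _ _ _ _ _ _ _ _ _ (@runs_map _ _ orc T 1 4
  (RDiv (rcur 4) (rcell 9)) (fun j => rmem s 4 j / rmem s1 9 0%N) s1 _)).
- move=> j s2 ltj /(it_inputs ok1)[h1 h2] e4 fr2 /=.
  by rewrite h2 e4 (fr2 9%N) // fr1.2.
- by rewrite ok1.1 //=; lia.
move=> s2 _ h.
have -> : output n s2 = (rmem s1 9 0%N)^-1 *: get_vec n s 4.
  apply/colP => j; rewrite !mxE h; first by rewrite mulrC.
  by rewrite ok1.1 //; apply: ltn_ord.
exact: (gk_final colA b_gt0 xs_pos eps01 lamstarP I lnr r0 hf max1 att1).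
Qed.

(** As [LF >= 1], this also gives [E >= 1], so additive constants can be absorbed into multiples of
    [E]. *)
Lemma log_factor_le_work : LF <= E.
Proof.
have /andP[e0 e1] := eps01; have LF1 := log_factor_ge1 R m.
have m1 : 1 <= m%:R :> R by rewrite ler1n (m_gt0 colA b_gt0 xs_pos lamstarP).
have eV : 1 <= (eps ^+ 2)^-1.
  by rewrite invf_ge1 ?exprn_gt0 // exprn_ile1 // ltW.
have h : LF <= m%:R * LF by rewrite ler_peMl //; lra.
by apply: (le_trans h); rewrite ler_peMl //; lra.
Qed.

(** The target is at most [48 E], so [f <= 48 E + 1]; with [g <= 2 f + 40 E] the sum is at most
    [184 E + 3], and [E >= 1]. *)
Lemma loop_inv_bound r j s : 0 < r -> r <= 3 * LF ->
  loop_inv (m%:R * (r / (eta * eta))) j s -> j%:R <= 187 * E.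
Proof.
move=> r0 rLF [_ _ _ [f [g [<- _ ftgt I]]]].
have gle := gk_raises_bound colA b_gt0 xs_pos eps01 lamstarP lamP I.
have /andP[e0 e1] := eps01; have LF1 := log_factor_ge1 R m.
have ELF := log_factor_le_work.
have tE : m%:R * (r / (eta * eta)) = 16 * ((eps ^+ 2)^-1 * (m%:R * r)).
  by field; rewrite gt_eqF.
have rE : (eps ^+ 2)^-1 * (m%:R * r) <= 3 * E.
  have -> : 3 * E = (eps ^+ 2)^-1 * (m%:R * (3 * LF)) by ring.
  apply: ler_wpM2l; first by rewrite invr_ge0 exprn_ge0 // ltW.
  exact: ler_wpM2l.
by rewrite natrD; lra.
Qed.

Lemma runs_packing_program :
  runs packing_program s0
    (Num.truncn (LF + 1) * 30 + 150 * N +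
      ((Num.truncn (187 * E) * (620 * N + T) + 10) + 250 * N))
    (fun s' => approx_solution A b c xs eps (output n s')).
Proof.
have N0 := nonzeros_gt0; have LF1 := log_factor_ge1 R m.
have ELF := log_factor_le_work.
apply: runs_seq; first exact: runs_prologue.
move=> s1 _ [r [r0 lnr rLF] J0].
apply: runs_seq.
  apply: (@runs_weaken _ _ _ _ _ _ _ _ _ _ (@runs_while _ _ orc T
    (TRLt (rcell 11) (rcell 12)) main_body (loop_inv (m%:R * (r / (eta * eta))))
    (600 * N + T) (Num.truncn (187 * E)) s1 J0 _ _)).
  - move=> j s /(loop_inv_bound r0 rLF) le.
    by rewrite truncn_ge_nat //; lra.
  - by move=> j s J1 lt; apply: runs_main_body.
  - apply: leq_add => //=; rewrite leq_mul2l; apply/orP; right; lia.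
  - by move=> s _ h; exact: h.
move=> s2 _ [j [ok _ t2 [f [g [_ cnt _ I]]]]] /=; rewrite -leNgt cnt t2 => hf.
exact: runs_epilogue I r0 lnr hf.
Qed.

(** The main loop contributes [187 * 620] times [E N], which leaves ample room for the other
    terms. *)
Lemma packing_time :
  (Num.truncn (LF + 1) * 30 + 150 * N +
      ((Num.truncn (187 * E) * (620 * N + T) + 10) + 250 * N))%:R
    <= (500 * 500) * (E * (N + T)%:R).
Proof.
have LF1 := log_factor_ge1 R m.
have ELF := log_factor_le_work.
have N1 : 1 <= N%:R :> R by rewrite ler1n nonzeros_gt0.
have T0 : 0 <= T%:R :> R by [].
have t1 : (Num.truncn (LF + 1))%:R <= LF + 1 by rewrite truncn_le; lra.
have t2 : (Num.truncn (187 * E))%:R <= 187 * E by rewrite truncn_le; lra.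
rewrite !(natrD, natrM).
set a := (Num.truncn (LF + 1))%:R in t1 *; set d := (Num.truncn _)%:R in t2 *.
set e := E in ELF t2 *; set N' := N%:R in N1 *; set T' := T%:R in T0 *.
have h1 : d * (620 * N' + T') <= 187 * e * (620 * N' + T').
  by apply: ler_wpM2r t2; lra.
(* Once the signs of these products are known, the estimate is linear in the monomials. *)
have e1 : 0 <= e - 1 by lra.
have N1' : 0 <= N' - 1 by lra.
have p1 := mulr_ge0 e1 N1'.
have e0 : 0 <= e by lra.
have p2 := mulr_ge0 e0 T0.
have p3 := mulr_ge0 e0 N1'.
lra.
Qed.

End Correctness.

Theorem theorem2 (R : realType) :
  exists P : cmd, forall kappa : R, 0 < kappa -> exists K : R,
  forall (m n k : nat) (A : 'M[nat]_(m, n)) (b : 'cV[nat]_m) (c : 'cV[int]_n)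
    (xs : 'I_k -> 'cV[R]_n) (eps lam lamstar : R)
    (orc : 'cV[R]_n -> option 'cV[R]_n) (T : nat),
  (forall i, exists j, (0 < A i j)%N) ->
  (forall j, exists i, (0 < A i j)%N) ->
  (forall i, (0 < b i 0%R)%N) ->
  (forall l, xs l != 0 /\ forall j, 0 <= xs l j 0) ->
  0 < eps < 1 ->
  separation_oracle xs orc ->
  kappa * n%:R <= T%:R ->
  is_min_ratio A b c xs eps lamstar ->
  lam <= lamstar <= (m%:R `^ (eps^-1 * m%:R)) * lam ->
  exists (s : state R) (t : nat),
    [/\ exec orc T P (init_state A b c eps lam) s t,
        t%:R <= K * ((eps ^+ 2)^-1 * (m%:R * log_factor R m)
                       * (size (nonzeros A) + T)%:R)
      & approx_solution A b c xs eps (output n s)].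
Proof.
exists packing_program => kappa _; exists (500 * 500).
move=> m n k A b c xs eps lam lamstar orc T rowA colA b0 xs0 eps01 orcP _ lsP lP.
have [s [t [ex le sol]]] := runs_packing_program T rowA colA b0 xs0 eps01 orcP lsP lP.
exists s, t; split=> //.
apply: le_trans (packing_time T rowA colA b0 xs0 eps01 lsP).
by rewrite ler_nat.
Qed.
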